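(* Let $Q\ge4$ be an integer, and let $A$ be a nonempty finite set of (distinct) positive integers, each coprime to $Q$, such that $$3a<Q\quad\text{for every }a\in A,\qquad \sum_{a\in A}a\le Q.$$ Then there is some $a\in A$ with $$\sum_{b\in A\setminus\{a\}}K_Q\!\left(\lVert ab^{-1}\rVert_Q\right)<1.$$
   Context: For integers $Q\ge2$ and $1\le d\le Q/2$, $K_Q(d)=\dfrac{\sin(\pi/Q)}{\sin(\pi d/Q)}$. For $x\not\equiv0\pmod Q$ with least positive residue $r\in\{1,\dots,Q-1\}$ modulo $Q$, $\lVert x\rVert_Q=\min\{r,Q-r\}$. Inverses $b^{-1}$ are taken modulo $Q$. *)

(* Defs.v *)
From HB Require Import structures.
From mathcomp Require Import all_boot all_order all_algebra finmap.
From mathcomp Require Import reals trigo.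
Set Implicit Arguments.
Unset Strict Implicit.
Unset Printing Implicit Defensive.
Import GRing.Theory.
Local Open Scope ring_scope.

(* Only meant for 1 <= d <= Q / 2; outside that range the value is whatever
   division in R gives. *)
Definition K (R : realType) (Q d : nat) : R :=
  sin (pi / Q%:R) / sin (pi * d%:R / Q%:R).

(* Residue classes modulo Q are elements of 'Z_Q, which is Z/QZ for Q >= 2.
   [val x] is the residue of [x] in {0, ..., Q - 1}, so for [x != 0] it is the
   least positive residue. The junk value at [x = 0] is 0. *)
Definition modnorm (Q : nat) (x : 'Z_Q) : nat := minn (val x) (Q - val x).

(* Main.v *)
Require Import Defs.
From HB Require Import structures.
From Stdlib Require Import NArith PeanoNat.
From mathcomp Require Import all_boot all_order all_algebra finmap.
From mathcomp Require Import reals trigo.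
From mathcomp Require Import classical_sets topology normedtype derive realfun.
From mathcomp Require Import zify ring lra.
Set Implicit Arguments.
Unset Strict Implicit.
Unset Printing Implicit Defensive.
Import Order.TTheory GRing.Theory Num.Theory.
Import numFieldNormedType.Exports.
Local Open Scope fset_scope.
Local Open Scope ring_scope.

(* Write f(c) for the sum attached to c, a for the least element of A, and d for
   the norm of c/b modulo Q. Then b d = k Q +- c for some k >= 0, with k = 0 only
   if b divides c, and K_Q(d) is close to 1/d, so that b contributes about
   b / (k Q -+ c) to f(c). In particular f(a) is at most about 1, and if f(a) >= 1
   then k = 1 for every b beyond roughly sqrt(Q)/4, i.e. b divides Q - a or Q + a.

   Let c be the least element of A that is not a multiple of a (if a >= 2), or
   not a power of 2 (if a = 1). If there is none, then f(a) < 1 directly. If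
   c^2 >= 4Q, write b e = Q +- a and c g = Q +- a for the large b not dividing c:
   then g d >= Q - e, so such a b contributes only about 1/c, and f(c) < 1.
   If c^2 < 4Q, then 2 f(a) + f(c) < 3: an element b > c dividing Q +- a has a
   large k with respect to c unless b = c + k (resp. b = a + c), and every other
   pair of contributions is at most lambda b plus a bounded slack, which is summed
   using that the elements add up to at most Q.

   These estimates work for Q >= 300 (a >= 2) and Q >= 1000 (a = 1). The remaining
   Q are settled by a branch-and-bound search with integer upper bounds of
   10^4 K_Q(d). *)

(** * Bounds on K *)

(** Row [a] alone just misses: the terms [b / (Q - a)] add up to at most 1, and what can push [f(a)]
    past 1 is only the surplus of [K_Q(d)] over [1 / d], in total of order [1 / sqrt Q]. The weights
    of [2 f(a) + f(c)] balance two kinds of elements: with [k = 1] in row [a] an element costs about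
    [2 b] plus a reduced share of row [c]; with [k >= 2] it costs about [2 (b / 2) + b = 2 b]. The
    choice of [c] controls the terms with [k = 0] in row [c], which come from divisors of [c]. For
    [a >= 2] there are none. For [a = 1] they are powers of 2 with sum at most [2 D - 1], where
    [c = D m] with [D] a power of 2 and [m] odd, so they take a share of about [2 / m <= 2 / 3].
    After multiplication by [Q - a] or [Q] the estimates are affine in the elements. Quadratic facts
    ([c^2 < 4 Q], [n^2 <= 2 Q] for [n] elements) are made linear by squares [(x - x0)^2 >= 0], with
    [x0] usually near the extreme value of [x] at the least [Q] treated. *)

Lemma ge0_of_derive (R : realType) (f df : R -> R) (x : R) :
  (forall y : R, is_derive y (1 : R) f (df y)) -> (forall y, 0 <= y -> 0 <= df y) ->
  0 <= f 0 -> 0 <= x -> 0 <= f x.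
Proof.
move=> fdf df0 f0 x0.
have [|c /andP[c0 _] fE] := @MVT_segment _ f df 0 x x0 (fun y _ => fdf y).
  by apply: derivable_within_continuous => y _; have [] := fdf y.
rewrite -(subrK (f 0) (f x)) fE subr0 addr_ge0// mulr_ge0// df0//.
Qed.

(** Starting from [cos <= 1], each of the three Taylor bounds follows from the previous one by
    [ge0_of_derive]. *)
Lemma sin_le_id (R : realType) (x : R) : 0 <= x -> sin x <= x.
Proof.
move=> x0; rewrite -subr_ge0.
apply: (@ge0_of_derive _ (fun y : R => y - sin y) (fun y => 1 - cos y) x _ _ _ x0).
- by move=> y _; rewrite subr_ge0 cos_le1.
- by rewrite sin0 subr0.
Qed.

Lemma cos_ge_poly2 (R : realType) (x : R) : 0 <= x -> 1 - x ^+ 2 / 2 <= cos x.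
Proof.
move=> x0; rewrite -subr_ge0.
apply: (@ge0_of_derive _ (fun y : R => cos y - (1 - y ^+ 2 / 2)) (fun y => y - sin y) x _ _ _ x0).
- move=> y; apply: is_derive_eq; rewrite /GRing.scale/=; by field.
- by move=> y y0; rewrite subr_ge0; exact: sin_le_id.
- by rewrite cos0 expr0n/=; lra.
Qed.

Lemma sin_ge_poly3 (R : realType) (x : R) : 0 <= x -> x - x ^+ 3 / 6 <= sin x.
Proof.
move=> x0; rewrite -subr_ge0.
apply: (@ge0_of_derive _ (fun y : R => sin y - (y - y ^+ 3 / 6))
  (fun y => cos y - (1 - y ^+ 2 / 2)) x _ _ _ x0).
- move=> y; apply: is_derive_eq; rewrite /GRing.scale/=; by field.
- by move=> y y0; rewrite subr_ge0; exact: cos_ge_poly2.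
- by rewrite sin0 expr0n/=; lra.
Qed.

(* [s = sin (pi / 6)] satisfies [(s + 1) (2 s - 1)^2 = 0] by the triple angle formula. *)
Lemma sin_pi6 (R : realType) : sin (pi / 6) = 1 / 2 :> R.
Proof.
set t := pi / 6 : R; set s := sin t.
have s3 : sin (t + t *+ 2) = 1.
  by rewrite (_ : t + t *+ 2 = pi / 2) ?sin_pihalf// /t; field.
have s0 : 0 < s.
  by apply: sin_gt0_pi; have := @pi_gt0 R; rewrite /t => ?; apply/andP; split; lra.
have c2 : cos t ^+ 2 = 1 - s ^+ 2 by rewrite cos2sin2.
have : (s + 1) * (2 * s - 1) ^+ 2 = 0.
  move: s3; rewrite sinD cos_mulr2n sin_mulr2n -/s => s3.
  have : s * (cos t ^+ 2 *+ 2 - 1) + 2 * s * cos t ^+ 2 = 1 by rewrite -[RHS]s3; ring.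
  by rewrite c2 => {}s3; lra.
move=> /eqP; rewrite mulf_eq0 expf_eq0/= => /orP[] /eqP; lra.
Qed.

(** The cubic bound at [t = pi / 6], where the sine is 1/2, gives [t - t^3 / 6 <= 1 / 2]. The crude
    bounds on [pi] put [t] where this cubic increases, and at [131 / 250] it already exceeds 1/2; so
    [pi <= 3.144]. *)
Lemma pi_sqr_le (R : realType) : pi ^+ 2 <= 99 / 10 :> R.
Proof.
have p0 := @pi_ge2 R; have p4 := @pihalf_lt2 R.
have := @sin_ge_poly3 R (pi / 6); rewrite sin_pi6; set t := pi / 6.
have [t0 t1] : 1 / 3 <= t /\ t < 2 / 3 by rewrite /t; split; lra.
have -> : pi = 6 * t by rewrite /t; field.
move=> /(_ ltac:(lra)) tP; suff : t <= 131 / 250 by nra.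
rewrite leNgt; apply/negP => tgt.
(* The product is the increase of [x - x^3 / 6] from [131 / 250] to [t]. *)
have : (t - 131 / 250) * (1 - (t ^+ 2 + t * (131 / 250) + (131 / 250)^+2) / 6) > 0.
  by apply: mulr_gt0; nra.
lra.
Qed.

(* Follows from [u - u^3 / 6 <= sin u <= u] and [pi^2 <= 99 / 10]; the point [D <= d]
   is free because [1 / sin] decreases on [0, pi / 2]. *)
Lemma K_le_rational (R : realType) (Q d : nat) (D : R) :
  0 < D -> D <= d%:R -> (2 * d <= Q)%N ->
  K R Q d <= Q%:R ^+ 2 / (D * (Q%:R ^+ 2 - 33 / 20 * D ^+ 2)).
Proof.
move=> D0 Dd dQ; have pi0 := @pi_gt0 R; have pi2 := @pi_sqr_le R.
have d0 : 0 < d%:R :> R by apply: lt_le_trans Dd.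
have dQR : 2 * d%:R <= Q%:R :> R by rewrite -natrM ler_nat.
have Q0 : 0 < Q%:R :> R by lra.
set u : R := pi * D / Q%:R; set t : R := pi * d%:R / Q%:R.
have u0 : 0 < u by rewrite /u divr_gt0// mulr_gt0.
have ut : u <= t by rewrite /u /t ler_pM2r ?invr_gt0// ler_pM2l.
have t2 : t <= pi / 2.
  by rewrite /t ler_pdivrMr//; nra.
have sut : sin u <= sin t.
  move: ut; rewrite le_eqVlt => /orP[/eqP -> //|ut].
  by rewrite ltW// ltr_sin// in_itv/=; apply/andP; split; lra.
have uE : u = pi * (D / Q%:R) by rewrite /u mulrA.
have q1 : 0 < D / Q%:R by rewrite divr_gt0.
have q2 : D / Q%:R <= 1 / 2 by rewrite ler_pdivrMr//; lra.
set q := D / Q%:R in uE q1 q2.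
have w0 : 0 < 1 - 33 / 20 * q ^+ 2 by nra.
(* [33 / 20] is the bound [99 / 10] of [pi ^+ 2] divided by the 6 of the cubic term. *)
have su : u * (1 - 33 / 20 * q ^+ 2) <= sin u.
  apply: le_trans (sin_ge_poly3 (ltW u0)).
  have -> : u - u ^+ 3 / 6 = u * (1 - u ^+ 2 / 6) by ring.
  rewrite ler_pM2l// lerB// uE exprMn.
  have : 0 < q ^+ 2 by rewrite exprn_gt0.
  nra.
have s0 : 0 < sin t by apply: lt_le_trans sut; apply: lt_le_trans su; rewrite mulr_gt0.
rewrite /K -/t.
have DQ : D = q * Q%:R by rewrite /q divfK// gt_eqF.
have E (p q' x : R) : 0 < p -> 0 < q' -> 0 < x -> 0 < 1 - 33 / 20 * q' ^+ 2 ->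
    x ^+ 2 / (q' * x * (x ^+ 2 - 33 / 20 * (q' * x) ^+ 2)) =
    (p / x) / (p * q' * (1 - 33 / 20 * q' ^+ 2)).
  move=> p1 q'1 xp w1; have x2 : 0 < x ^+ 2 by rewrite exprn_gt0.
  by field; rewrite !gt_eqF//=; nra.
rewrite DQ (E pi q Q%:R)// -uE.
apply: ler_pM.
- apply: sin_ge0_pi; rewrite divr_ge0 ?(ltW pi0) ?(ltW Q0)//=.
  by rewrite ler_pdivrMr// ler_peMr ?(ltW pi0)// ler1n -(ltr0n R).
- by rewrite invr_ge0 ltW.
- by apply: sin_le_id; rewrite divr_ge0// ltW.
- rewrite lef_pV2; [exact: le_trans su sut|by rewrite posrE|by rewrite posrE mulr_gt0].
Qed.

(** * The distance function *)

Definition dist (Q a b : nat) : nat := modnorm (a%:R * b%:R^-1 : 'Z_Q).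

Lemma dist_inv (Q a b x : nat) : (1 < Q)%N -> (b * x %% Q = 1)%N ->
  dist Q a b = minn ((a * x) %% Q) (Q - (a * x) %% Q).
Proof.
move=> Q1 bx.
have bx1 : b%:R * x%:R = 1 :> 'Z_Q.
  rewrite -natrM -[1]/(1%:R); apply: ord_inj.
  by rewrite !(val_Zp_nat Q1) bx modn_small.
have bu : b%:R \is a @GRing.unit 'Z_Q by apply/unitrP; exists x%:R; rewrite mulrC bx1.
have -> : dist Q a b = modnorm ((a * x)%:R : 'Z_Q).
  by congr modnorm; rewrite natrM -[x%:R](mulKr bu) bx1 mulr1.
have E : val ((a * x)%:R : 'Z_Q) = ((a * x) %% Q)%N := val_Zp_nat Q1 _.
by rewrite /modnorm E.
Qed.

Lemma coprime_modinv (Q b : nat) : (1 < Q)%N -> coprime b Q ->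
  exists x, (b * x %% Q = 1)%N.
Proof.
move=> Q1 bQ; have b0 : (0 < b)%N by case: b bQ => //; rewrite /coprime gcd0n; lia.
have [x y E _] := egcdnP Q b0; exists x.
by rewrite mulnC E (eqP bQ) modnMDl modn_small.
Qed.

(** If [v] is the residue of [a] times the inverse of [b], then [b v] is [a] plus a multiple of [Q],
    and passing to [Q - v] flips the sign of [a]. The analytic estimates see modular inverses only
    through these equations. *)
Lemma distP (Q a b : nat) : (1 < Q)%N -> coprime b Q -> (a < Q)%N ->
  (2 * dist Q a b <= Q)%N /\
  exists k, (b * dist Q a b = k * Q + a)%N \/ (b * dist Q a b + a = k * Q)%N.
Proof.
move=> Q1 bQ aQ; have [x bx] := coprime_modinv Q1 bQ.
rewrite (dist_inv a Q1 bx); set v := ((a * x) %% Q)%N.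
have vQ : (v < Q)%N by rewrite ltn_mod; lia.
have bv : (b * v = b * v %/ Q * Q + a)%N.
  rewrite {1}(divn_eq (b * v) Q); congr addn.
  by rewrite /v modnMmr mulnCA -modnMmr bx muln1 modn_small.
split; first by lia.
have [?|?] := leqP v (Q - v).
  by exists (b * v %/ Q)%N; left; lia.
exists (b - b * v %/ Q)%N; right.
set k := (b * v %/ Q)%N in bv *.
have bvQ : (b * v <= b * Q)%N by rewrite leq_mul2l (ltnW vQ) orbT.
rewrite mulnBr mulnBl; move: bv bvQ.
by move: (b * v)%N (b * Q)%N (k * Q)%N => X Y Z; clear => *; lia.
Qed.

Section Dist.
Variables (Q a b : nat).
Hypotheses (Q1 : (1 < Q)%N) (bQ : coprime b Q) (a0 : (0 < a)%N) (aQ : (2 * a <= Q)%N).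

Let aQ' : (a < Q)%N. Proof. lia. Qed.

Lemma dist_le_half : (2 * dist Q a b <= Q)%N.
Proof. by have [] := distP Q1 bQ aQ'. Qed.

Lemma dist_ge : (a <= b * dist Q a b)%N.
Proof. by have [_ [[|k] E]] := distP Q1 bQ aQ'; nia. Qed.

Lemma dist_gt0 : (0 < dist Q a b)%N.
Proof. have := dist_ge; case: (dist Q a b) => [|//]; rewrite muln0; lia. Qed.

Lemma dist_ge_ndvd : ~~ (b %| a)%N -> (Q <= b * dist Q a b + a)%N.
Proof.
move=> ba; have [_ [[|k] E]] := distP Q1 bQ aQ'; last by nia.
case: E => E; last by lia.
by move: ba; rewrite -[a]add0n -(mul0n Q) -E dvdn_mulr.
Qed.

Lemma dist_ge_ndvd2 : ~~ (b %| a)%N -> ~~ (b %| Q - a)%N -> ~~ (b %| Q + a)%N ->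
  (2 * Q <= b * dist Q a b + a)%N.
Proof.
move=> ba bm bp; have [_ [k E]] := distP Q1 bQ aQ'.
case: k E => [|[|k]] E.
- case: E => E; last by lia.
  by move: ba; rewrite -[a]add0n -(mul0n Q) -E dvdn_mulr.
- case: E => E; first by move: bp; rewrite -[Q]mul1n -E dvdn_mulr.
  by move: bm; rewrite -[Q]mul1n -E addnK dvdn_mulr.
- have k2 : (2 * Q <= k.+2 * Q)%N by rewrite leq_mul2r orbT.
  by move: k2 E; move: (k.+2 * Q)%N (b * _)%N => x y; clear => *; lia.
Qed.

End Dist.

(* The bound of [K_le_rational] at [D = (Q - a) / u], times [Q - a], is at most
   [u + excess u]. *)
Definition excess (R : realType) (b : R) : R := 33 * b / (20 * b ^+ 2 - 33).

Section KBounds.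
Variables (R : realType) (Q : nat).
Implicit Types (a b d : nat).
Local Notation q := (Q%:R : R).

(** The bound of [K_le_rational] at [D = d] exceeds [1 / d] by a quantity increasing in [d], which
    at [d = Q / 2] equals [66 / 47 / Q]; [141 / 100] rounds this up. *)
Lemma K_le_lin d b (t : R) : (0 < d)%N -> (2 * d <= Q)%N -> 0 < t -> t <= b%:R * d%:R ->
  K R Q d <= b%:R / t + 141 / 100 / q.
Proof.
move=> d0 dQ t0 tbd.
have dR : 0 < d%:R :> R by rewrite ltr0n.
have dQR : 2 * d%:R <= q by rewrite -natrM ler_nat.
have q0 : 0 < q by lra.
apply: le_trans (K_le_rational dR (lexx _) dQ) _.
have w0 : 0 < q ^+ 2 - 33 / 20 * d%:R ^+ 2 by nra.
have -> : q ^+ 2 / (d%:R * (q ^+ 2 - 33 / 20 * d%:R ^+ 2)) =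
   1 / d%:R + 33 / 20 * d%:R / (q ^+ 2 - 33 / 20 * d%:R ^+ 2).
  by field; rewrite !gt_eqF//=; nra.
apply: lerD.
  rewrite -subr_ge0.
  have -> : b%:R / t - 1 / d%:R = (b%:R * d%:R - t) / (t * d%:R).
    by field; rewrite !gt_eqF.
  by rewrite divr_ge0 ?subr_ge0// mulr_ge0// ltW.
rewrite -subr_ge0.
have -> : 141 / 100 / q - 33 / 20 * d%:R / (q ^+ 2 - 33 / 20 * d%:R ^+ 2) =
  (141 / 100 * (q ^+ 2 - 33 / 20 * d%:R ^+ 2) - 33 / 20 * d%:R * q) /
  (q * (q ^+ 2 - 33 / 20 * d%:R ^+ 2)).
  by field; rewrite !gt_eqF//=; nra.
rewrite divr_ge0//; first by nra.
by rewrite mulr_ge0 ?ltW.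
Qed.

(** With [D = (Q - a) / u] and [Q - a <= Q], the error relative to [1 / (Q - a)] depends on [u]
    alone and decays like [1 / u]. The error in [K_le_lin] is the same for every [b], which would be
    too much when summed over row [a]. *)
Lemma K_le_excess d a (u : R) : (a < Q)%N -> 2 <= u -> (2 * d <= Q)%N ->
  q - a%:R <= u * d%:R -> K R Q d <= (u + excess u) / (q - a%:R).
Proof.
move=> aQ uR dQ dR.
have aR : a%:R < q by rewrite ltr_nat.
have a0 : 0 <= a%:R :> R by [].
set p := q - a%:R in dR *; have p0 : 0 < p by rewrite /p; lra.
have D0 : 0 < p / u by rewrite divr_gt0//; lra.
apply: le_trans (K_le_rational D0 _ dQ) _; first by rewrite ler_pdivrMr; [rewrite mulrC|lra].
have pq : p <= q by rewrite /p; lra.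
have u2 : 0 < 20 * u ^+ 2 - 33 by nra.
have p2 : p ^+ 2 <= q ^+ 2 by rewrite ler_sqr// nnegrE; lra.
have p20 : 0 < p ^+ 2 by rewrite exprn_gt0.
have w : 0 < 20 * u ^+ 2 * q ^+ 2 - 33 * p ^+ 2.
  have : (20 * u ^+ 2 - 33) * p ^+ 2 <= (20 * u ^+ 2 - 33) * q ^+ 2.
    by rewrite ler_pM2l.
  have : 0 < (20 * u ^+ 2 - 33) * p ^+ 2 by rewrite mulr_gt0.
  lra.
have E (u' v y : R) : 0 < u' -> 0 < v -> 0 < 20 * u' ^+ 2 * y ^+ 2 - 33 * v ^+ 2 ->
    y ^+ 2 / (v / u' * (y ^+ 2 - 33 / 20 * (v / u') ^+ 2)) =
    (20 * u' ^+ 3 * y ^+ 2 / (20 * u' ^+ 2 * y ^+ 2 - 33 * v ^+ 2)) / v.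
  by move=> u'0 v0 uv0; field; rewrite !gt_eqF.
rewrite E//; last by lra.
rewrite ler_pM2r ?invr_gt0//.
have -> : u + excess u = 20 * u ^+ 3 / (20 * u ^+ 2 - 33).
  by rewrite /excess; field; rewrite gt_eqF.
rewrite ler_pdivrMr// [leRHS]mulrAC ler_pdivlMr//.
have : 0 < u ^+ 3 by rewrite exprn_gt0//; lra.
move: (u ^+ 3) => u3 u30.
rewrite -subr_ge0.
have -> : 20 * u3 * (20 * u ^+ 2 * q ^+ 2 - 33 * p ^+ 2) -
  20 * u3 * q ^+ 2 * (20 * u ^+ 2 - 33) = 660 * u3 * (q ^+ 2 - p ^+ 2) by ring.
by rewrite mulr_ge0// ?subr_ge0// mulr_ge0// ltW.
Qed.

Lemma excess_ge0 (u : R) : 2 <= u -> 0 <= excess u.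
Proof. by move=> u2; rewrite /excess divr_ge0//; nra. Qed.

Lemma excess_anti (u v : R) : 2 <= u -> u <= v -> excess v <= excess u.
Proof.
move=> u2 uv; rewrite /excess -subr_ge0.
have u3 : 0 < 20 * u ^+ 2 - 33 by nra.
have v3 : 0 < 20 * v ^+ 2 - 33 by nra.
have -> : 33 * u / (20 * u ^+ 2 - 33) - 33 * v / (20 * v ^+ 2 - 33) =
  33 * (v - u) * (20 * (u * v) + 33) / ((20 * u ^+ 2 - 33) * (20 * v ^+ 2 - 33)).
  by field; rewrite !gt_eqF.
have uv0 : 0 <= u * v by rewrite mulr_ge0//; lra.
by apply: divr_ge0; apply: mulr_ge0; lra.
Qed.

Lemma K_le_far d a b : (a < Q)%N -> (0 < b)%N -> (2 * d <= Q)%N -> (2 * Q <= b * d + a)%N ->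
  K R Q d <= (b%:R / 2 + 141 / 100) / (q - a%:R).
Proof.
move=> aQ b1 dQ Qbd.
have bR : 1 <= b%:R :> R by rewrite ler1n.
have aR : a%:R < q by rewrite ltr_nat.
have a0 : 0 <= a%:R :> R by [].
have dR : 2 * q <= b%:R * d%:R + a%:R by rewrite -!natrM -natrD ler_nat.
have d0 : (0 < d)%N by nia.
apply: le_trans (@K_le_lin d b (2 * (q - a%:R)) d0 dQ _ _) _; [lra|lra|].
have -> : b%:R / (2 * (q - a%:R)) = b%:R / 2 / (q - a%:R) :> R by field; rewrite gt_eqF//; lra.
rewrite [leRHS]mulrDl lerD2l ler_pM2l; last by lra.
by rewrite lef_pV2 ?posrE; lra.
Qed.

End KBounds.

(** * Sums over sets of integers *)

Lemma ler_sum_sub (R : realDomainType) (s t : seq nat) (P : pred nat) (F : nat -> R) :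
  uniq s -> {in s, forall b, P b -> b \in t} -> {in t, forall b, 0 <= F b} ->
  \sum_(b <- s | P b) F b <= \sum_(b <- t) F b.
Proof.
move=> us st F0; rewrite -big_filter.
have sub : {subset [seq b <- s | P b] <= t}.
  by move=> b; rewrite mem_filter => /andP[Pb /st]; apply.
have : uniq [seq b <- s | P b] by rewrite filter_uniq.
move: [seq b <- s | P b] sub {st} => r; elim: r t F0 => [|b r IH] t F0 sub.
  by rewrite big_nil big_seq sumr_ge0.
move=> /= /andP[br ur]; rewrite big_cons.
have bt : b \in t by apply: sub; rewrite mem_head.
rewrite (perm_big _ (perm_to_rem bt)) big_cons lerD2l; apply: IH => //.
  by move=> x /mem_rem; apply: F0.
move=> x xr; have : x \in t by apply: sub; rewrite in_cons xr orbT.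
rewrite (perm_mem (perm_to_rem bt)) in_cons => /orP[/eqP xb|//].
by rewrite -xb xr in br.
Qed.

Lemma ler_sum_window (R : realDomainType) (s : seq nat) (P : pred nat) (m n : nat) (G : nat -> R) :
  uniq s -> {in s, forall b, P b -> (m <= b)%N} -> (forall b, (m <= b < n)%N -> 0 <= G b) ->
  \sum_(b <- s | P b) (if (b < n)%N then G b else 0) <= \sum_(m <= b < n) G b.
Proof.
move=> us ms G0; rewrite -big_mkcondr/=.
apply: ler_sum_sub => // b; last by rewrite mem_index_iota; apply: G0.
by move=> bs /andP[Pb bn]; rewrite mem_index_iota bn ms.
Qed.

Lemma sumn_sub (s t : seq nat) (P : pred nat) :
  uniq s -> {in s, forall b, P b -> b \in t} ->
  (\sum_(b <- s | P b) b <= \sum_(b <- t) b)%N.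
Proof.
move=> us st.
have := @ler_sum_sub int s t P (fun b => b%:R) us st (fun b _ => ler0n _ b).
by rewrite -!natr_sum ler_nat.
Qed.

(** [k] distinct positive integers add up to at least [k (k + 1) / 2]. So an admissible set has at
    most [sqrt (2 Q)] elements, which bounds the total of constant errors. *)
Lemma sqr_size_le (s : seq nat) : uniq s -> {in s, forall b, (0 < b)%N} ->
  (size s ^ 2 <= 2 * \sum_(b <- s) b)%N.
Proof.
(* Induction on an upper bound of the elements: [n.+1], if present, exceeds the number of the other
   elements. *)
suff H n : forall s, uniq s -> {in s, forall b, (0 < b <= n)%N} ->
    (size s ^ 2 <= 2 * \sum_(b <- s) b)%N.
  move=> us s0; apply: (H (\sum_(b <- s) b)%N) => // b bs.
  by rewrite s0//= (big_rem b)//= leq_addr.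
elim: n => [|n IH] {}s us sn.
  by case: s us sn => [|b s] // _ /(_ b (mem_head _ _)); lia.
have [ns|ns] := boolP (n.+1 \in s); last first.
  apply: IH => // b bs; have /andP[-> /=] := sn b bs; rewrite leq_eqVlt => /orP[/eqP E|//].
  by rewrite -E bs in ns.
have ur := rem_uniq n.+1 us.
have rn : {in rem n.+1 s, forall b, (0 < b <= n)%N}.
  move=> b; rewrite (rem_filter _ us) mem_filter/= => /andP[bn bs].
  by have := sn b bs; lia.
rewrite (perm_big _ (perm_to_rem ns)) big_cons; have := IH _ ur rn.
have : (size (rem n.+1 s) <= n)%N.
  have := @uniq_leq_size _ (rem n.+1 s) (iota 1 n) ur; rewrite size_iota; apply.
  by move=> b /rn; rewrite mem_iota; lia.
have -> : size s = (size (rem n.+1 s)).+1.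
  by rewrite size_rem// prednK//; case: (s) ns.
move: (size _) (\sum_(b <- rem _ _) b)%N => k S; rewrite -!mulnn => kn kS. rewrite /=; nia.
Qed.

Definition pow2 (b : nat) : bool := (b == 2 ^ trunc_log 2 b)%N.

Lemma pow2P b : reflect (exists i, b = 2 ^ i)%N (pow2 b).
Proof.
apply: (iffP eqP) => [->|[i ->]]; first by eexists.
by rewrite trunc_expnK.
Qed.

Lemma sum_pow2_lt (s : seq nat) (P : pred nat) (x : nat) : uniq s -> (0 < x)%N ->
  {in s, forall b, P b -> pow2 b && (b <= x)%N} -> (\sum_(b <- s | P b) b < 2 * x)%N.
Proof.
move=> us x0 sP; set t := [seq (2 ^ i)%N | i <- iota 0 (trunc_log 2 x).+1].
have : (\sum_(b <- s | P b) b <= \sum_(b <- t) b)%N.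
  apply: sumn_sub => // b bs /(sP b bs)/andP[/pow2P[i bi] bx].
  apply/mapP; exists i; rewrite // mem_iota/= add0n ltnS.
  by rewrite trunc_log_max// -bi.
move=> /leq_ltn_trans; apply; rewrite big_map.
have -> : (\sum_(i <- iota 0 (trunc_log 2 x).+1) 2 ^ i = 2 ^ (trunc_log 2 x).+1 - 1)%N.
  elim: (trunc_log 2 x).+1 => [|k IH]; first by rewrite big_nil.
  by rewrite -addn1 iotaD big_cat/= IH big_cons big_nil add0n addn0 expnD; have := expn_gt0 2 k; lia.
have := trunc_logP (ltnSn 1) x0; rewrite expnS; have := expn_gt0 2 (trunc_log 2 x); lia.
Qed.

Lemma bigD1_seq_cond (R : nmodType) (s : seq nat) (P : pred nat) (F : nat -> R) (b : nat) :
  uniq s -> b \in s -> P b ->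
  \sum_(c <- s | P c) F c = F b + \sum_(c <- s | P c && (c != b)) F c.
Proof.
move=> us bs Pb; rewrite -big_filter (bigD1_seq b) ?filter_uniq//; last by rewrite mem_filter Pb.
by rewrite big_filter_cond.
Qed.

(** * Rows of an admissible set *)

Definition Kd (R : realType) (Q a b : nat) : R := K R Q (dist Q a b).

Definition rowsum (R : realType) (Q : nat) (s : seq nat) (a : nat) : R :=
  \sum_(b <- s | b != a) Kd R Q a b.

Record admissible (Q : nat) (s : seq nat) : Prop := Admissible {
  adm_Q : (4 <= Q)%N;
  adm_uniq : uniq s;
  adm_gt0 : {in s, forall b, (0 < b)%N};
  adm_coprime : {in s, forall b, coprime b Q};
  adm_lt : {in s, forall b, (3 * b < Q)%N};
  adm_sum : (\sum_(b <- s) b <= Q)%N }.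

(** From [b = 11 + sqrt Q / 4] on, a loss of [b / 2] in row [a] exceeds the total
    [51 / 10 + sqrt (2 Q) / 12] of all excesses, with room for the [29 / 100] that occurs in
    [large_dvd]. *)
Definition small (Q b : nat) : bool := (b <= 11)%N || (16 * (b - 11) ^ 2 < Q)%N.

Lemma excess_nat_le (R : realType) (b m : nat) : (2 <= b)%N ->
  (3300 * b + 33 * m <= 20 * m * b ^ 2)%N -> excess (b%:R : R) <= m%:R / 100.
Proof.
move=> b2; rewrite -(ler_nat R) natrD !natrM => H.
have bR : 2 <= b%:R :> R by rewrite ler_nat.
by rewrite /excess ler_pdivrMr; nra.
Qed.

Section Rows.
Variables (R : realType) (Q : nat) (s : seq nat).
Hypothesis adm : admissible Q s.
Local Notation q := (Q%:R : R).

Let Q4 := adm_Q adm.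
Let us := adm_uniq adm.
Let s0 := adm_gt0 adm.
Let sQ := adm_coprime adm.
Let s3 := adm_lt adm.
Let Q1 : (1 < Q)%N. Proof. lia. Qed.

Lemma sum_others (a : nat) : a \in s -> (\sum_(b <- s | b != a) b <= Q - a)%N.
Proof.
move=> as_; have := adm_sum adm; rewrite (bigD1_seq a)//= => H.
lia.
Qed.

Lemma sum_others_real (a : nat) : a \in s ->
  \sum_(b <- s | b != a) b%:R <= q - a%:R.
Proof.
move=> as_; rewrite -natr_sum -natrB; last by have := s3 as_; lia.
by rewrite ler_nat sum_others.
Qed.

Lemma sdist_le_half (a b : nat) : a \in s -> b \in s -> (2 * dist Q a b <= Q)%N.
Proof.
move=> as_ bs; have a3 := s3 as_; have b3 := s3 bs.
by apply: dist_le_half; rewrite ?sQ ?s0//; lia.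
Qed.

Lemma sdist_gt0 (a b : nat) : a \in s -> b \in s -> (0 < dist Q a b)%N.
Proof. by move=> as_ bs; have := s3 as_ => ?; apply: dist_gt0; rewrite ?sQ ?s0//; lia. Qed.

Lemma sdist_ge (a b : nat) : a \in s -> b \in s -> (a <= b * dist Q a b)%N.
Proof. by move=> as_ bs; have := s3 as_ => ?; apply: dist_ge; rewrite ?sQ ?s0//; lia. Qed.

Lemma sdist_ndvd (a b : nat) : a \in s -> b \in s -> ~~ (b %| a)%N ->
  (Q <= b * dist Q a b + a)%N.
Proof. by move=> as_ bs; have := s3 as_ => ?; apply: dist_ge_ndvd; rewrite ?sQ ?s0//; lia. Qed.

Lemma sdist_ndvd2 (a b : nat) : a \in s -> b \in s -> ~~ (b %| a)%N ->
  ~~ (b %| Q - a)%N -> ~~ (b %| Q + a)%N -> (2 * Q <= b * dist Q a b + a)%N.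
Proof. by move=> as_ bs; have := s3 as_ => ?; apply: dist_ge_ndvd2; rewrite ?sQ ?s0//; lia. Qed.

Lemma Kd_le_excess (a b : nat) : a \in s -> b \in s -> ~~ (b %| a)%N ->
  Kd R Q a b <= (b%:R + excess b%:R) / (q - a%:R).
Proof.
move=> as_ bs ba; apply: K_le_excess.
- by have := s3 as_; lia.
- by rewrite ler_nat; case: b bs ba => [/s0|[_|]]//; rewrite dvd1n.
- exact: sdist_le_half.
- by rewrite lerBlDr -natrM -natrD ler_nat sdist_ndvd.
Qed.

Lemma Kd_le_far (a b : nat) : a \in s -> b \in s -> ~~ (b %| a)%N ->
  ~~ (b %| Q - a)%N -> ~~ (b %| Q + a)%N ->
  Kd R Q a b <= (b%:R / 2 + 141 / 100) / (q - a%:R).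
Proof.
move=> as_ bs ba bm bp; apply: K_le_far.
- by have := s3 as_; lia.
- exact: s0.
- exact: sdist_le_half.
- exact: sdist_ndvd2.
Qed.

Section Min.
Variable a : nat.
Hypotheses (as_ : a \in s) (amin : {in s, forall b, (a <= b)%N}).

Lemma min_ndvd (b : nat) : b \in s -> b != a -> ~~ (b %| a)%N.
Proof.
move=> bs ba; apply/negP => /(dvdn_leq (s0 as_)).
by have := amin bs; lia.
Qed.

Lemma sum_excess_lt20 : \sum_(2 <= b < 20) excess (b%:R : R) <= 51 / 10.
Proof.
(* The entry at [b - 2] bounds [100 * excess b] from above; the entries add up to 510. *)
pose m := [:: 141; 68; 46; 36; 29; 25; 22; 19; 17; 16; 14; 13; 12; 12; 11; 10; 10; 9]%N.
apply: (@le_trans _ _ (\sum_(2 <= b < 20) (nth 0%N m (b - 2))%:R / 100)).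
  rewrite big_nat [leRHS]big_nat; apply: ler_sum => b b20; apply: excess_nat_le; first by lia.
  by move: b b20; do 2 (case; first by []); do 18 (case; first by move=> _; rewrite [nth _ _ _]/=; lia).
rewrite -mulr_suml ler_pdivrMr// -natr_sum (_ : \sum_(_ <= _ < _) _ = 510)%N; first by lra.
by rewrite unlock.
Qed.

(** From 20 on each excess is at most [excess 20 < 1 / 12]; smaller elements cost at most the full
    sum from 2 to 19, whichever of them occur. *)
Lemma sum_excess_le : \sum_(b <- s | b != a) excess (b%:R : R) <= 51 / 10 + 1 / 12 * (size s)%:R.
Proof.
have s2 b : b \in s -> b != a -> (2 <= b)%N.
  by move=> bs ba; have := amin bs; have := s0 as_; lia.
apply: (@le_trans _ _ (\sum_(b <- s | b != a) ((if (b < 20)%N then excess b%:R else 0) + 1 / 12))).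
  rewrite big_seq_cond [leRHS]big_seq_cond; apply: ler_sum => b /andP[bs ba].
  have b2 : 2 <= b%:R :> R by rewrite ler_nat s2.
  case: ifPn => [_|]; first by lra.
  rewrite -leqNgt -(ler_nat R) => b20; rewrite add0r.
  apply: le_trans (@excess_anti R 20 b%:R _ b20) _; first by lra.
  by rewrite /excess ler_pdivrMr; lra.
rewrite big_split/=; apply: lerD.
  apply: le_trans sum_excess_lt20; apply: ler_sum_window => // b /andP[b2 _].
  by rewrite excess_ge0// ler_nat.
rewrite big_const_seq iter_addr_0 -[leLHS]mulr_natr; apply: ler_wpM2l; first by lra.
by rewrite ler_nat count_size.
Qed.

(** At full contributions the row is at most 1 plus the excesses. An element dividing neither
    [Q - a] nor [Q + a] loses about half of its weight, and beyond [small] this loss outweighs all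
    excesses together. *)
Lemma large_dvd (b : nat) : 1 <= rowsum R Q s a -> b \in s -> b != a -> ~~ small Q b ->
  (b %| Q - a)%N || (b %| Q + a)%N.
Proof.
move=> f1 bs ba; rewrite negb_or -ltnNge -leqNgt => /andP[b11 bbig].
apply/negP => /negP; rewrite negb_or => /andP[bm bp].
have aQ := s3 as_.
have aR : 3 * a%:R < q by rewrite -natrM ltr_nat.
have p0 : 0 < q - a%:R by have : 0 <= a%:R :> R by []; lra.
have bR : 12 <= b%:R :> R by rewrite ler_nat.
(* [2 Q <= b d + a] implies [2 (Q - a) <= b d], so [u = b / 2] is allowed. As [b / 2 >= 6], the
   error is at most [29 / 100], far below the [141 / 100] of [Kd_le_far]. *)
have Kb : Kd R Q a b <= (b%:R / 2 + excess (b%:R / 2)) / (q - a%:R).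
  apply: K_le_excess; [by lia|by lra|exact: sdist_le_half|].
  have := sdist_ndvd2 as_ bs (min_ndvd bs ba) bm bp.
  rewrite -(ler_nat R) natrD !natrM; have : 0 <= a%:R :> R by [].
  lra.
have xb : excess (b%:R / 2 : R) <= 29 / 100.
  apply: le_trans (@excess_anti R 6 _ _ _) _; [lra|lra|by rewrite /excess ler_pdivrMr; lra].
have E : rowsum R Q s a * (q - a%:R) <=
    \sum_(c <- s | c != a) c%:R + \sum_(c <- s | c != a) excess c%:R - b%:R / 2 + 29 / 100.
  rewrite -big_split/= /rowsum 2!(bigD1_seq_cond _ us bs ba)//=.
  rewrite mulrDl mulr_suml.
  have x0 : 0 <= excess (b%:R : R) by apply: excess_ge0; lra.
  have : Kd R Q a b * (q - a%:R) <= b%:R / 2 + 29 / 100.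
    by move: Kb; rewrite ler_pdivlMr//; lra.
  suff : \sum_(c <- s | (c != a) && (c != b)) Kd R Q a c * (q - a%:R) <=
    \sum_(c <- s | (c != a) && (c != b)) (c%:R + excess c%:R) by lra.
  rewrite big_seq_cond [leRHS]big_seq_cond; apply: ler_sum => c /and3P[cs ca cb].
  by rewrite -ler_pdivlMr// Kd_le_excess// min_ndvd.
have := sum_excess_le; have := sum_others_real as_.
set N : R := (size s)%:R => h1 h2.
have N2 : N ^+ 2 <= 2 * q.
  rewrite /N -natrX -natrM ler_nat.
  by apply: leq_trans (sqr_size_le us s0) _; rewrite leq_mul2l adm_sum.
have bb : q <= 16 * (b%:R - 11) ^+ 2.
  by move: bbig; rewrite -(ler_nat R) natrM natrX natrB// ltnW.
have N0 : 0 <= N by [].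
(* From [N ^+ 2 <= 2 q <= 32 (b - 11) ^+ 2]; [566 / 100] rounds up [sqrt 32]. *)
have Nb : N <= 566 / 100 * (b%:R - 11).
  rewrite leNgt; apply/negP => ?; nra.
have := ler_peMl (ltW p0) f1; lra.
Qed.

End Min.
End Rows.

(** * Branch-and-bound search *)

Delimit Scope N_scope with BN.
Local Open Scope N_scope.

Definition scale : N := 10000.

(* Upper bound of [scale * K Q d], from [K_le_rational] at [D = d]. *)
Definition kbound (Q d : N) : N :=
  (scale * 20 * Q * Q) / (d * (20 * Q * Q - 33 * d * d)) + 1.

Definition cdist (Q a x : N) : N := let r := (a * x) mod Q in N.min r (Q - r).

(* Extended Euclid with fuel [n]; its answers are checked by [certified], so that
   nothing has to be proved about it. *)
Fixpoint euclid (n : nat) (Q r0 r1 s0 s1 : N) : N * N :=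
  if n is S n then
    if r1 =? 0 then (r0, s0)
    else let (q, r) := N.div_eucl r0 r1 in
         euclid n Q r1 r s1 ((s0 + (Q - q * s1 mod Q)) mod Q)
  else (0, 0).

Fixpoint range (n : nat) (i : N) : seq N :=
  if n is S n then i :: range n (i + 1) else [::].

Definition smallN (Q b : N) : bool := (b <=? 11) || (16 * ((b - 11) * (b - 11)) <? Q).

Definition inverses (Q : N) (bs : seq N) : seq (N * (N * N)) :=
  [seq (b, euclid 30 Q b Q 1 0) | b <- bs].

(** Either [x] inverts [b], or [g > 1] is a common divisor, so that [b] cannot occur in an
    admissible set. This guarantees that [units] misses no admissible element. *)
Definition certified (Q : N) (e : N * (N * N)) : bool :=
  let: (b, (g, x)) := e in
  ((b * x) mod Q =? 1) || [&& 1 <? g, b mod g =? 0 & Q mod g =? 0].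

Definition units (Q : N) (es : seq (N * (N * N))) : seq (N * N) :=
  [seq (e.1, e.2.2) | e <- es & (e.1 * e.2.2) mod Q =? 1].

(* If [b * g = n] with [n = Q - a] or [n = Q + a], then [g * xa] is, up to sign, the
   inverse of [b] modulo [Q], where [xa] is the inverse of [a]; the sign does not
   change the distance. *)
Definition codivisors (Q n xa : N) (gs : seq N) : seq (N * N) :=
  [seq (n / g, (g * xa) mod Q) | g <- gs &
     (n mod g =? 0) && ~~ smallN Q (n / g) && (3 * (n / g) <? Q)].

Definition candidates (Q a xa : N) (us : seq (N * N)) (gs : seq N) : seq (N * N) :=
  [seq e <- us | (a <? e.1) && smallN Q e.1] ++
  [seq e <- codivisors Q (Q - a) xa gs ++ codivisors Q (Q + a) xa gs | a <? e.1].

Definition sumN (l : seq N) : N := foldr N.add 0 l.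

(* Either the values of all candidates add up to less than [scale], or the value
   of a subset of weight at most [Q - a] does, by linear duality with multiplier
   [lam]. *)
Definition light (Q a : N) (l : seq (N * N)) : bool :=
  let lam := scale / (Q - a) in
  (sumN [seq e.2 | e <- l] <? scale) ||
  (lam * (Q - a) + sumN [seq e.2 - lam * e.1 | e <- l] <? scale).

(* An item is (weight, value in row [a], value in row [c]). If both rows reach
   [scale], twice the first plus the second reaches [3 * scale]; this is refuted
   by linear duality with multiplier [lam]. *)
Definition dual (Q : N) (r : seq (N * N * N)) (m va vc : N) : bool :=
  let lam := (9 * scale) / (4 * Q) in
  2 * va + vc + lam * m + sumN [seq 2 * e.1.2 + e.2 - lam * e.1.1 | e <- r] <? 3 * scale.

(* No subset of [r] of weight at most [m] brings both [va] and [vc] up to [scale]. *)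
Fixpoint branch (Q : N) (r : seq (N * N * N)) (m va vc : N) : bool :=
  if dual Q r m va vc then true else
  if r is e :: r' then
    if branch Q r' m va vc then
      if m <? e.1.1 then true
      else branch Q r' (m - e.1.1) (va + e.1.2) (vc + e.2)
    else false
  else if va <? scale then true else vc <? scale.

(** The candidates that fail this test are those eligible as second row, by the same criterion as in
    the analytic part. *)
Definition tameN (a c : N) : bool :=
  if a =? 1 then c =? 2 ^ N.log2 c else c mod a =? 0.

(** [c] stands for the least element that is not tame, so any other such candidate must exceed [c];
    hence the filter. The mutual contributions of [a] and [c] are entered from the start, and both
    weights are deducted from [Q]. *)
Definition check_pair (Q a xa : N) (l : seq (N * N * N)) (c : N * N * N) : bool :=
  let: (c, xc, kc) := c in
  if tameN a c then true else
  branch Q [seq (e.1.1, e.2, kbound Q (cdist Q c e.1.2)) | e <- l &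
            ~~ (e.1.1 =? c) && ((c <? e.1.1) || tameN a e.1.1)]
    (Q - a - c) kc (kbound Q (cdist Q c xa)).

(** Either row [a] stays below 1 for every possible set, or it does so for sets of tame elements and
    each choice of the least non-tame element [c] is refuted. *)
Definition check_min (Q : N) (us : seq (N * N)) (gs : seq N) (e : N * N) : bool :=
  let: (a, xa) := e in
  let l := [seq (e, kbound Q (cdist Q a e.2)) | e <- candidates Q a xa us gs] in
  if light Q a [seq (e.1.1, e.2) | e <- l] then true else
  if light Q a [seq (e.1.1, e.2) | e <- l & tameN a e.1.1] then
    all (check_pair Q a xa l) l
  else false.

(** A cofactor [g] of a non-small [b] satisfies [3 <= g <= Q / 9]: [b g] lies between [2 Q / 3] and
    [4 Q / 3], while [12 <= b < Q / 3]. *)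
Definition check_all (Q : N) : bool :=
  let es := inverses Q (range (N.to_nat (Q / 3)) 1) in
  let us := units Q es in
  all (certified Q) es && all (check_min Q us (range (N.to_nat (Q / 9)) 3)) us.

(** For least element 1 and [Q < 1000] only: then small elements are at most 18 and cofactors of the
    others at most 62. *)
Definition check_one (Q : N) : bool :=
  let es := inverses Q (range 20 1) in
  all (certified Q) es && check_min Q (units Q es) (range 60 3) (1, 1).

(** * Soundness of the search *)

Lemma to_nat_mod (m d : N) : N.to_nat (m mod d) = (N.to_nat m %% N.to_nat d)%N.
Proof.
rewrite N2Nat.inj_mod; move: (N.to_nat m) (N.to_nat d) => {}m {}d.
case: d => [|d]; first by rewrite modn0.
have := PeanoNat.Nat.div_mod_eq m d.+1; have := PeanoNat.Nat.mod_upper_bound m d.+1.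
move: (Nat.div _ _) (Nat.modulo _ _) => u v /(_ ltac:(lia)) vd ->.
have -> : (d.+1 * u + v)%coq_nat = (u * d.+1 + v)%N by lia.
by rewrite modnMDl modn_small//; lia.
Qed.

Lemma to_nat_sumN (l : seq N) : N.to_nat (sumN l) = (\sum_(x <- l) N.to_nat x)%N.
Proof. by elim: l => [|x l IH]; rewrite ?big_nil// big_cons /= N2Nat.inj_add IH. Qed.

Lemma sumN_cons (x : N) (l : seq N) : sumN (x :: l) = x + sumN l.
Proof. by []. Qed.

(** Weak duality for a knapsack: truncated subtraction in [N] is the positive part of [f - lam g],
    so its sum over all of [l] dominates the sum of [f - lam g] over the selected items. *)
Lemma sumN_excess (lam : N) (T : Type) (f g : T -> N) (m : bitseq) (l : seq T) :
  size m = size l ->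
  sumN [seq f e | e <- mask m l] <=
  lam * sumN [seq g e | e <- mask m l] + sumN [seq f e - lam * g e | e <- l].
Proof.
elim: l m => [|e l IH] [|[] m]//=; [by move=> _; lia| |]; move=> [/IH {}IH]; lia.
Qed.

Lemma light_sound (Q a : N) (l t : seq (N * N)) : light Q a l -> subseq t l ->
  sumN [seq e.1 | e <- t] <= Q - a -> scale <= sumN [seq e.2 | e <- t] -> False.
Proof.
move=> + /subseqP[m /esym sm tE]; rewrite tE => /orP[|] /N.ltb_lt ll h1 h2.
  have := @sumN_excess 0 _ snd fst m l (esym sm).
  have -> : [seq e.2 - 0 * e.1 | e <- l] = [seq e.2 | e <- l] by apply: eq_map => e; lia.
  by rewrite N.mul_0_l => h3; move: ll h2 h3; move: (sumN _) (sumN _) scale => *; lia.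
have := @sumN_excess (scale / (Q - a)) _ snd fst m l (esym sm).
move: ll h1 h2; move: (scale / (Q - a)) => lam.
move: (sumN [seq e.1 | e <- mask m l]) (sumN [seq e.2 | e <- mask m l]) => x y.
move: (sumN _) scale => z w *; nia.
Qed.

Lemma branch_sound (Q : N) (r t : seq (N * N * N)) (m va vc : N) :
  branch Q r m va vc -> subseq t r ->
  sumN [seq e.1.1 | e <- t] <= m ->
  scale <= va + sumN [seq e.1.2 | e <- t] ->
  scale <= vc + sumN [seq e.2 | e <- t] -> False.
Proof.
have dual_sound r' m' (va' vc' : N) b : dual Q r' m' va' vc' -> size b = size r' ->
    sumN [seq e.1.1 | e <- mask b r'] <= m' ->
    scale <= va' + sumN [seq e.1.2 | e <- mask b r'] ->
    scale <= vc' + sumN [seq e.2 | e <- mask b r'] -> False.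
  rewrite /dual; move: (9 * scale / (4 * Q)) => lam /N.ltb_lt dd sb h1 h2 h3.
  have := @sumN_excess lam _ (fun e : N * N * N => 2 * e.1.2 + e.2) (fun e => e.1.1) b r' sb.
  have -> : sumN [seq 2 * e.1.2 + e.2 | e <- mask b r'] =
      2 * sumN [seq e.1.2 | e <- mask b r'] + sumN [seq e.2 | e <- mask b r'].
    elim: (mask b r') => [|e u IH]; first by [].
    by rewrite !map_cons !sumN_cons IH; move: (sumN _) (sumN _) => *; lia.
  move: dd h1 h2 h3.
  move: (sumN [seq e.1.1 | e <- mask b r']) (sumN [seq e.1.2 | e <- mask b r']).
  move: (sumN [seq e.2 | e <- mask b r']) (sumN _) scale => x y z w v *; nia.
move=> + /subseqP[b sb ->].
elim: r b m va vc sb => [|e r IH] [|c b] m va vc //; rewrite [branch _ _ _ _ _]/= => sb.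
  case: ifP => [/(@dual_sound [::] m va vc [::])/(_ erefl) H _|_]; first exact: H.
  by case: ifP => [/N.ltb_lt|_ /N.ltb_lt]; rewrite /= !N.add_0_r; move: scale => *; lia.
case: ifP => [/(@dual_sound (e :: r) m va vc (c :: b))/(_ sb) H _|_]; first exact: H.
case: sb => sb; case: ifP => // b1.
case: c; rewrite ?mask_cons ?map_cons ?sumN_cons; last by move=> _; apply: (IH b).
case: ifP => [/N.ltb_lt|/N.ltb_ge me b2 h1 h2 h3].
  by move: (sumN _) => x *; lia.
apply: (IH b _ _ _ sb b2); move: h1 h2 h3.
- by move: (sumN _) (sumN _) (sumN _) scale => *; lia.
- by move: (sumN _) (sumN _) (sumN _) scale => *; lia.
- by move: (sumN _) (sumN _) (sumN _) scale => *; lia.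
Qed.

Definition signed_inverse (Q b x : nat) : Prop :=
  (b * x %% Q = 1)%N \/ ((b * x + 1) %% Q = 0)%N.

Lemma dist_signed_inverse (Q a b x : nat) : (1 < Q)%N -> signed_inverse Q b x ->
  dist Q a b = minn ((a * x) %% Q) (Q - (a * x) %% Q).
Proof.
move=> Q1 [/(dist_inv a Q1)//|bx].
have : ((b * (x %% Q) + 1) %% Q = 0)%N by rewrite -modnDml modnMmr modnDml.
have xQ : (x %% Q < Q)%N by rewrite ltn_mod; lia.
have axE : ((a * x) %% Q = (a * (x %% Q)) %% Q)%N by rewrite modnMmr.
rewrite {}axE; move: (x %% Q)%N xQ => {bx} {}x xQ /eqP/dvdnP[t tE].
have bx' : (b * (Q - x) %% Q = 1)%N.
  have b0 : (0 < b)%N by case: (b) tE => // tE; have := leq_mul2r Q 1 t; nia.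
  have tb : (t <= b)%N.
    rewrite leqNgt; apply/negP => bt.
    have : (b.+1 * Q <= t * Q)%N by rewrite leq_mul2r bt orbT.
    have : (b * x <= b * Q.-1)%N by rewrite leq_mul2l; lia.
    nia.
  have -> : (b * (Q - x) = (b - t) * Q + 1)%N.
    by rewrite mulnBr mulnBl -tE; have : (b * x <= b * Q)%N; [rewrite leq_mul2l; lia|];
       have : (t * Q <= b * Q)%N; [rewrite leq_mul2r; lia|]; lia.
  by rewrite modnMDl modn_small.
rewrite (dist_inv a Q1 bx'); set v := (a * x %% Q)%N.
have vQ : (v < Q)%N by rewrite ltn_mod; lia.
have : ((a * (Q - x) + v) %% Q = 0)%N.
  by rewrite /v modnDmr -mulnDr subnK ?modnMl// ltnW.
rewrite -modnDml; move: (a * (Q - x) %% Q)%N (ltn_pmod (a * (Q - x)) (ltnW Q1)) => w wQ.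
move=> /eqP/dvdnP[k E]; have : (k < 2)%N by nia.
by case: k E => [|[|]]// E _; lia.
Qed.

Lemma cdist_dist (Q a b : nat) (x : N) : (1 < Q)%N -> signed_inverse Q b (N.to_nat x) ->
  N.to_nat (cdist (N.of_nat Q) (N.of_nat a) x) = dist Q a b.
Proof.
move=> Q1 bx; rewrite (dist_signed_inverse a Q1 bx) /cdist.
have : N.to_nat ((N.of_nat a * x) mod N.of_nat Q) = (a * N.to_nat x %% Q)%N.
  by rewrite to_nat_mod N2Nat.inj_mul !Nat2N.id.
lia.
Qed.

Lemma K_le_kbound (R : realType) (Q d : nat) : (0 < d)%N -> (2 * d <= Q)%N ->
  (K R Q d <= (N.to_nat (kbound (N.of_nat Q) (N.of_nat d)))%:R / (N.to_nat scale)%:R)%R.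
Proof.
move=> d0 dQ; set D := N.of_nat d; set QN := N.of_nat Q; set S := N.to_nat scale.
have S0 : (0 < S)%N by [].
pose n := (S * 20 * Q * Q)%N; pose m := (d * (20 * Q * Q - 33 * d * d))%N.
have dd : (33 * d * d < 20 * Q * Q)%N by nia.
have m0 : (0 < m)%N by rewrite /m muln_gt0 d0 subn_gt0.
have E : (n <= N.to_nat (kbound QN D) * m)%N.
  have : n = N.to_nat (scale * 20 * QN * QN) by rewrite /n /S /QN !N2Nat.inj_mul !Nat2N.id.
  have : m = N.to_nat (D * (20 * QN * QN - 33 * D * D)).
    by rewrite /m /D /QN N2Nat.inj_mul N2Nat.inj_sub !N2Nat.inj_mul !Nat2N.id.
  rewrite /kbound; move: (scale * _ * _ * _) (D * _) => u v mv nu.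
  have v0 : v <> 0 by lia.
  have := N.mul_succ_div_gt u v v0; rewrite -N.add_1_r nu mv.
  by move: (u / v) => w; nia.
have dR : (0 < d%:R :> R)%R by rewrite ltr0n.
apply: le_trans (K_le_rational dR (lexx _) dQ) _.
have mR : (m%:R = d%:R * (20 * Q%:R ^+ 2 - 33 * d%:R ^+ 2) :> R)%R.
  by rewrite /m natrM natrB ?(ltnW dd)// !natrM; ring.
have nR : (n%:R = S%:R * 20 * Q%:R ^+ 2 :> R)%R by rewrite /n !natrM; ring.
have m0R : (0 < m%:R :> R)%R by rewrite ltr0n.
have -> : (Q%:R ^+ 2 / (d%:R * (Q%:R ^+ 2 - 33 / 20 * d%:R ^+ 2)) = 20 * Q%:R ^+ 2 / m%:R :> R)%R.
  have w : (0 < 20 * Q%:R ^+ 2 - 33 * d%:R ^+ 2 :> R)%R by move: m0R; rewrite mR pmulr_rgt0.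
  by rewrite mR; field; rewrite !gt_eqF//; lra.
rewrite ler_pdivrMr// [leRHS]mulrAC ler_pdivlMr; last by rewrite ltr0n.
have : (n%:R <= (N.to_nat (kbound QN D))%:R * m%:R :> R)%R by rewrite -natrM ler_nat.
by rewrite nR -mulrA mulrC.
Qed.

Lemma eqb_of_nat (x : N) (c : nat) : (x =? N.of_nat c) = (N.to_nat x == c).
Proof. by apply/idP/idP; lia. Qed.

Lemma ltb_of_nat (x : N) (c : nat) : (N.of_nat c <? x) = (c < N.to_nat x)%N.
Proof. by apply/idP/idP; lia. Qed.

Section Sound.
Variables (R : realType) (Q : nat) (s : seq nat).
Hypothesis adm : admissible Q s.
Let us := adm_uniq adm.
Let Q1 : (1 < Q)%N. Proof. have := adm_Q adm; lia. Qed.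
Let QN := N.of_nat Q.
Notation cost a x := (kbound QN (cdist QN (N.of_nat a) x)).

Lemma rowsum_cost (a : nat) (t : seq (N * N)) : a \in s ->
  (1 <= rowsum R Q s a)%R ->
  {in t, forall e, signed_inverse Q (N.to_nat e.1) (N.to_nat e.2)} ->
  perm_eq [seq N.to_nat e.1 | e <- t] [seq b <- s | b != a] ->
  scale <= sumN [seq cost a e.2 | e <- t].
Proof.
move=> as_ f1 tinv tperm.
have S0 : (0 < N.to_nat scale)%N by [].
suff : (N.to_nat scale <= \sum_(e <- t) N.to_nat (cost a e.2))%N.
  by rewrite -(big_map (fun e => cost a e.2) xpredT N.to_nat) -to_nat_sumN; move: scale => ?; lia.
rewrite -(ler_nat R) natr_sum -[leLHS]mul1r -ler_pdivlMr ?ltr0n//.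
apply: le_trans f1 _; rewrite /rowsum -[leLHS]big_filter -(perm_big _ tperm) big_map mulr_suml.
rewrite big_seq [leRHS]big_seq; apply: ler_sum => e et.
have es : N.to_nat e.1 \in s.
  have : N.to_nat e.1 \in [seq b <- s | b != a] by rewrite -(perm_mem tperm); apply/mapP; exists e.
  by rewrite mem_filter => /andP[].
rewrite /Kd -(cdist_dist a Q1 (tinv e et)) -[X in K R Q X](Nat2N.id).
rewrite -[X in kbound QN X]N2Nat.id Nat2N.id; apply: K_le_kbound.
  by rewrite (cdist_dist a Q1 (tinv e et)); apply: (sdist_gt0 adm).
by rewrite (cdist_dist a Q1 (tinv e et)); apply: (sdist_le_half adm).
Qed.

(** Nothing prevents [l] from listing an element twice; [undup] keeps one pair for each element and
    the order of the list, as the soundness of the search speaks of subsequences. *)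
Lemma select_candidates (a : nat) (l : seq (N * N)) :
  {in s, forall b, b != a -> exists x, (N.of_nat b, x) \in l} ->
  exists2 t, subseq t l & perm_eq [seq N.to_nat e.1 | e <- t] [seq b <- s | b != a].
Proof.
move=> sl; set s' := [seq b <- s | b != a].
pose l' := [seq e <- l | N.to_nat e.1 \in s'].
have /subseqP[m sm mE] := undup_subseq [seq N.to_nat e.1 | e <- l'].
exists (mask m l').
  by apply: (subseq_trans (mask_subseq _ _)); apply: filter_subseq.
rewrite map_mask -mE; apply: uniq_perm; [exact: undup_uniq|exact: filter_uniq|].
move=> b; rewrite mem_undup; apply/mapP/idP => [[e]|].
  by rewrite mem_filter => /andP[es _] ->.
move=> bs'; have := bs'; rewrite mem_filter => /andP[ba bs].
have [x bx] := sl b bs ba; exists (N.of_nat b, x); rewrite /= ?Nat2N.id//.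
by rewrite mem_filter /= Nat2N.id bs'.
Qed.

Lemma sum_candidates (m : nat) (t : seq (N * N)) (P : pred nat) :
  perm_eq [seq N.to_nat e.1 | e <- t] [seq b <- s | P b] ->
  (\sum_(b <- s | P b) b <= m)%N -> sumN [seq e.1 | e <- t] <= N.of_nat m.
Proof.
move=> tperm sm; have : (N.to_nat (sumN [seq e.1 | e <- t]) <= m)%N; last by lia.
rewrite to_nat_sumN big_map; apply: leq_trans sm.
by rewrite -[leqRHS]big_filter -(perm_big _ tperm) big_map.
Qed.

(** By contradiction: if every row reaches 1, the set itself is a selection of candidates that the
    check has excluded. Completeness of the candidates is asked only under [1 <= rowsum R Q s a],
    because it rests on [large_dvd]. *)
Lemma check_min_sound (a : nat) (xa : N) (uN : seq (N * N)) (gs : seq N) :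
  a \in s -> signed_inverse Q a (N.to_nat xa) ->
  {in candidates QN (N.of_nat a) xa uN gs, forall e, signed_inverse Q (N.to_nat e.1) (N.to_nat e.2)} ->
  ((1 <= rowsum R Q s a)%R ->
    {in s, forall b, b != a -> exists x, (N.of_nat b, x) \in candidates QN (N.of_nat a) xa uN gs}) ->
  check_min QN uN gs (N.of_nat a, xa) -> exists2 c, c \in s & (rowsum R Q s c < 1)%R.
Proof.
rewrite /check_min; set l := candidates _ _ _ _ _; set l3 := [seq (e, _) | e <- l].
move=> as_ ainv linv lfull chk.
apply/hasP; apply: contraT; rewrite -all_predC => /allP/= allge.
have {allge}ge1 c : c \in s -> (1 <= rowsum R Q s c)%R by move=> /allge; rewrite -leNgt.
have [t tl tperm] := select_candidates (lfull (ge1 a as_)).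
have tinv : {in t, forall e, signed_inverse Q (N.to_nat e.1) (N.to_nat e.2)}.
  by move=> e /(mem_subseq tl) /linv.
pose t3 := [seq (e, cost a e.2) | e <- t].
have t3l : subseq t3 l3 by apply: map_subseq.
have tsum : sumN [seq e.1 | e <- t] <= N.of_nat (Q - a).
  exact: (sum_candidates tperm (sum_others adm as_)).
have tcost := rowsum_cost as_ (ge1 a as_) tinv tperm.
have subE : N.of_nat (Q - a) = QN - N.of_nat a by exact: Nat2N.inj_sub.
have lightF l' : subseq t3 l' -> ~ light QN (N.of_nat a) [seq (e.1.1, e.2) | e <- l'].
  move=> t3l' /light_sound; apply; first exact: (map_subseq _ t3l').
    by rewrite -!map_comp -subE.
  by rewrite -!map_comp.
case: ifP chk => [/(lightF _ t3l)//|_]; case: ifP => // tame /allP chk.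
pose wild := [pred c | (c \in s) && (c != a) && ~~ tameN (N.of_nat a) (N.of_nat c)].
have tmem e : e \in t -> (N.to_nat e.1 \in s) && (N.to_nat e.1 != a).
  move=> et; have : N.to_nat e.1 \in [seq b <- s | b != a].
    by rewrite -(perm_mem tperm); apply/mapP; exists e.
  by rewrite mem_filter andbC.
have exw : exists c, wild c.
  have [/hasP[c cs cw]|] := boolP (has wild s); first by exists c.
  rewrite -all_predC => /allP/= notw; case: (@lightF [seq e <- l3 | tameN (N.of_nat a) e.1.1] _ tame).
  rewrite subseq_filter t3l andbT; apply/allP => _ /mapP[e et ->] /=.
  have /andP[es ea] := tmem e et.
  by have := notw _ es; rewrite es ea/= negbK N2Nat.id.
case: (ex_minnP exw) => c /andP[/andP[cs ca] cw] cmin.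
have /mapP[[c' xc] ct /= cE] : c \in [seq N.to_nat e.1 | e <- t].
  by rewrite (perm_mem tperm) mem_filter ca.
have {c' cE} ct : (N.of_nat c, xc) \in t by rewrite cE N2Nat.id.
have := chk _ (mem_subseq t3l (map_f _ ct)).
rewrite /check_pair (negbTE cw).
pose t' := [seq e <- t | ~~ (e.1 =? N.of_nat c)].
move=> /branch_sound br; exfalso.
have t'perm : perm_eq [seq N.to_nat e.1 | e <- t'] [seq b <- s | (b != a) && (b != c)].
  have -> : [seq N.to_nat e.1 | e <- t'] = [seq b <- [seq N.to_nat e.1 | e <- t] | b != c].
    by rewrite filter_map; congr map; apply: eq_filter => e /=; rewrite eqb_of_nat.
  have -> : [seq b <- s | (b != a) && (b != c)] = [seq b <- [seq b <- s | b != a] | b != c].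
    by rewrite -filter_predI; apply: eq_filter => b /=; rewrite andbC.
  exact: perm_filter.
have Eab : (\sum_(b <- s | (b != a) && (b != c)) b <= Q - a - c)%N.
  have := sum_others adm as_; rewrite (bigD1_seq_cond _ us cs ca)/=.
  by move: (\sum_(_ <- _ | _) _)%N => S H; clear -H; rewrite /= in H; lia.
have t'sum := sum_candidates t'perm Eab.
have t'inv : {in t', forall e, signed_inverse Q (N.to_nat e.1) (N.to_nat e.2)}.
  by move=> e; rewrite mem_filter => /andP[_ /tinv].
have permc (x : nat) (P : pred nat) : x \in s -> P x -> perm_eq
    (x :: [seq b <- s | P b && (b != x)]) [seq b <- s | P b].
  move=> xs Px; apply: uniq_perm; rewrite /= ?filter_uniq// ?andbT.
    by rewrite mem_filter eqxx andbF.
  by move=> b; rewrite in_cons !mem_filter; case: eqVneq => [->|_]; rewrite ?Px ?xs// andbT.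
apply: (br [seq (e.1, cost a e.2, cost c e.2) | e <- t']).
- rewrite (_ : [seq _ | e <- t'] = [seq (e.1.1, e.2, cost c e.1.2) |
     e <- [seq (e, cost a e.2) | e <- t']]); last by rewrite -map_comp.
  apply: map_subseq; rewrite subseq_filter; apply/andP; split; last first.
    by apply: subseq_trans t3l; apply: map_subseq; apply: filter_subseq.
  apply/allP => _ /mapP[e + ->] /=; rewrite mem_filter => /andP[ec et].
  rewrite ec/=; case: (boolP (tameN _ e.1)) => [_|ew]; first by rewrite orbT.
  rewrite orbF; have /andP[es ea] := tmem e et.
  have := cmin (N.to_nat e.1); rewrite /wild/= es ea N2Nat.id ew => /(_ erefl).
  by move: ec; rewrite eqb_of_nat ltb_of_nat ltn_neqAle eq_sym => -> ->.
- by rewrite -map_comp; move: t'sum; rewrite /QN !Nat2N.inj_sub.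
- have := @rowsum_cost a ((N.of_nat c, xc) :: t') as_ (ge1 a as_).
  rewrite map_cons sumN_cons -!map_comp; apply.
    by move=> e; rewrite in_cons => /orP[/eqP ->|/t'inv//]; apply: tinv.
  apply: (perm_trans _ (permc c (fun b => b != a) cs ca)).
  by rewrite /= Nat2N.id perm_cons.
- have := @rowsum_cost c ((N.of_nat a, xa) :: t') cs (ge1 c cs).
  rewrite map_cons sumN_cons -!map_comp; apply.
    by move=> e; rewrite in_cons => /orP[/eqP ->|/t'inv//]; rewrite /= Nat2N.id.
  apply: (perm_trans _ (permc a (fun b => b != c) as_ _)); last by rewrite eq_sym.
  rewrite /= Nat2N.id perm_cons; apply: (perm_trans t'perm).
  rewrite (_ : [seq b <- s | (b != a) && (b != c)] = [seq b <- s | (b != c) && (b != a)])//.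
  by apply: eq_filter => b; rewrite andbC.
Qed.

End Sound.

Lemma mem_range (n : nat) (i x : N) : (x \in range n i) = (i <=? x) && (x <? i + N.of_nat n).
Proof.
elim: n i => [|n IH] i; first by rewrite in_nil; apply/idP/idP; lia.
rewrite in_cons IH; have -> : (x == i) = (x =? i) by [].
by apply/idP/idP; lia.
Qed.

Lemma smallN_small (Q b : nat) : smallN (N.of_nat Q) (N.of_nat b) = small Q b.
Proof.
rewrite /smallN /small -mulnn.
have -> : (N.of_nat b <=? 11) = (b <= 11)%N by apply/idP/idP; lia.
congr orb.
have -> : 16 * ((N.of_nat b - 11) * (N.of_nat b - 11)) = N.of_nat (16 * ((b - 11) * (b - 11))).
  by rewrite !Nat2N.inj_mul !Nat2N.inj_sub.
by move: (16 * _)%N => u; apply/idP/idP; lia.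
Qed.

Lemma modN_eqb (n g : nat) (r : nat) :
  (N.of_nat n mod N.of_nat g =? N.of_nat r) = (n %% g == r)%N.
Proof.
have E := to_nat_mod (N.of_nat n) (N.of_nat g); rewrite !Nat2N.id in E.
by rewrite -E; move: (_ mod _) => u; apply/idP/idP; lia.
Qed.

(** * Completeness of the candidate lists *)

Section Complete.
Variables (R : realType) (Q : nat) (s : seq nat).
Hypothesis adm : admissible Q s.
Let s0 := adm_gt0 adm.
Let s3 := adm_lt adm.
Let Q1 : (1 < Q)%N. Proof. have := adm_Q adm; lia. Qed.
Let QN := N.of_nat Q.

Definition unit_pair (e : N * N) : Prop := (N.to_nat e.1 * N.to_nat e.2 %% Q = 1)%N.

Lemma codivisors_signed_inverse (a : nat) (n xa : N) (gs : seq N) : (a < Q)%N ->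
  (a * N.to_nat xa %% Q = 1)%N -> n = QN - N.of_nat a \/ n = QN + N.of_nat a ->
  {in codivisors QN n xa gs, forall e, signed_inverse Q (N.to_nat e.1) (N.to_nat e.2)}.
Proof.
move=> aQ axa nE _ /mapP[g + ->] /=; rewrite mem_filter => /andP[/andP[/andP[/N.eqb_eq ng _] _] _].
have n0 : n <> 0 by move: nE; rewrite /QN; lia.
have g0 : g <> 0 by move=> g0; rewrite g0 N.mod_0_r in ng.
have nbg : (N.to_nat (n / g) * N.to_nat g = N.to_nat n)%N.
  by have := N.div_mod n g g0; rewrite ng N.add_0_r => {2}->; rewrite N2Nat.inj_mul mulnC.
have xE : N.to_nat ((g * xa) mod QN) = (N.to_nat g * N.to_nat xa %% Q)%N.
  by rewrite to_nat_mod N2Nat.inj_mul /QN Nat2N.id.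
rewrite /signed_inverse xE; case: nE => nE.
  right; rewrite -modnDml modnMmr mulnA nbg modnDml.
  have -> : N.to_nat n = (Q - a)%N by rewrite nE /QN N2Nat.inj_sub !Nat2N.id.
  by rewrite -[1%N]axa modnDmr -mulnDl subnK ?(ltnW aQ)// modnMr.
left; rewrite modnMmr mulnA nbg.
have -> : N.to_nat n = (Q + a)%N by rewrite nE /QN N2Nat.inj_add !Nat2N.id.
by rewrite mulnDl [(Q * _)%N]mulnC modnMDl.
Qed.

Lemma candidates_signed_inverse (a : nat) (xa : N) (uN : seq (N * N)) (gs : seq N) : (a < Q)%N ->
  (a * N.to_nat xa %% Q = 1)%N -> {in uN, forall e, unit_pair e} ->
  {in candidates QN (N.of_nat a) xa uN gs, forall e, signed_inverse Q (N.to_nat e.1) (N.to_nat e.2)}.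
Proof.
move=> aQ axa uU e; rewrite /candidates mem_cat !mem_filter => /orP[/andP[_ /uU]|/andP[_]].
  by left.
rewrite mem_cat => /orP[].
  by apply: (codivisors_signed_inverse aQ axa); left.
by apply: (codivisors_signed_inverse aQ axa); right.
Qed.

Lemma candidates_complete (a : nat) (xa : N) (uN : seq (N * N)) (gs : seq N) :
  a \in s -> {in s, forall b, (a <= b)%N} ->
  {in s, forall b, small Q b -> exists x, (N.of_nat b, x) \in uN} ->
  (forall b g, b \in s -> ~~ small Q b -> (b * g = Q - a \/ b * g = Q + a)%N -> N.of_nat g \in gs) ->
  (1 <= rowsum R Q s a)%R ->
  {in s, forall b, b != a -> exists x, (N.of_nat b, x) \in candidates QN (N.of_nat a) xa uN gs}.
Proof.
move=> as_ amin hu hg f1 b bs ba.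
have ab : (a < b)%N by have := amin b bs; lia.
have abN : N.of_nat a <? N.of_nat b by lia.
have [bsm|bsm] := boolP (small Q b).
  have [x bx] := hu b bs bsm; exists x.
  by rewrite mem_cat mem_filter /= abN smallN_small bsm bx.
have codiv n : (b %| n)%N -> (0 < n)%N -> N.of_nat (n %/ b) \in gs ->
    exists x, (N.of_nat b, x) \in codivisors QN (N.of_nat n) xa gs.
  move=> /dvdnP[g nE] n0; rewrite nE mulnK ?s0// => ggs.
  have g0 : (0 < g)%N by move: n0; rewrite nE; case: (g).
  have bE : N.of_nat (g * b) / N.of_nat g = N.of_nat b.
    by rewrite Nat2N.inj_mul N.mul_comm N.div_mul//; lia.
  exists ((N.of_nat g * xa) mod QN); apply/mapP; exists (N.of_nat g); rewrite ?bE//.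
  rewrite mem_filter ggs bE smallN_small bsm andbT (modN_eqb _ _ 0) modnMr eqxx andTb.
  have bQ := s3 bs; rewrite /QN; lia.
have aQ := s3 as_.
have /orP[bd|bd] := large_dvd adm as_ amin f1 bs ba bsm.
  have [||x bx] := codiv _ bd; [by lia|by apply: (hg b) => //; left; rewrite mulnC divnK|].
  exists x; rewrite /candidates mem_cat !mem_filter /= abN mem_cat -Nat2N.inj_sub bx.
  by rewrite orbT.
have [||x bx] := codiv _ bd; [by lia|by apply: (hg b) => //; right; rewrite mulnC divnK|].
exists x; rewrite /candidates mem_cat !mem_filter /= abN mem_cat -Nat2N.inj_add bx.
by rewrite !orbT.
Qed.

Lemma units_complete (n : nat) :
  all (certified QN) (inverses QN (range n 1)) ->
  {in s, forall b, (b <= n)%N -> exists x, (N.of_nat b, x) \in units QN (inverses QN (range n 1))}.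
Proof.
move=> /allP cert b bs bn.
have brange : N.of_nat b \in range n 1 by rewrite mem_range; have := s0 bs; lia.
have [[g x] eb] : exists e, (N.of_nat b, e) \in inverses QN (range n 1).
  by exists (euclid 30 QN (N.of_nat b) QN 1 0); apply/mapP; exists (N.of_nat b).
have := cert _ eb; rewrite /certified => /orP[bx|/and3P[g1 gb gQ]].
  by exists x; apply/mapP; exists (N.of_nat b, (g, x)); rewrite // mem_filter eb andbT.
have := adm_coprime adm bs; rewrite /coprime => /eqP cbQ.
have gE : g = N.of_nat (N.to_nat g) by rewrite N2Nat.id.
rewrite gE in gb gQ; rewrite !(modN_eqb _ _ 0) in gb gQ.
have : (N.to_nat g %| gcdn b Q)%N by rewrite dvdn_gcd /dvdn gb gQ.
by rewrite cbQ dvdn1; lia.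
Qed.

Lemma units_unit (es : seq (N * (N * N))) : {in units QN es, forall e, unit_pair e}.
Proof.
move=> _ /mapP[e + ->]; rewrite mem_filter /unit_pair /= => /andP[/N.eqb_eq + _].
by move/(congr1 N.to_nat); rewrite to_nat_mod N2Nat.inj_mul /QN Nat2N.id.
Qed.

Lemma exists_min : s != [::] -> exists2 a, a \in s & {in s, forall b, (a <= b)%N}.
Proof.
case: (s) => // x r _; have ex : exists a, a \in x :: r by exists x; rewrite mem_head.
by case: (ex_minnP ex) => a ar amin; exists a.
Qed.

Lemma check_all_sound : s != [::] -> check_all QN ->
  exists2 c, c \in s & (rowsum R Q s c < 1)%R.
Proof.
rewrite /check_all => sn /andP[cert /allP chk].
have [a as_ amin] := exists_min sn.
have le3 b : b \in s -> (b <= N.to_nat (QN / 3))%N.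
  move=> bs; have bQ := s3 bs.
  have : N.of_nat b <= QN / 3 by apply: N.div_le_lower_bound; rewrite /QN; lia.
  by move: (QN / 3) => u ub; lia.
have [xa axa] := units_complete cert as_ (le3 a as_).
have /= axa1 := units_unit axa; rewrite /unit_pair /= Nat2N.id in axa1.
have aQ := s3 as_.
apply: (check_min_sound adm as_ _ _ _ (chk _ axa)).
- by left.
- by apply: candidates_signed_inverse => //; [lia|exact: units_unit].
- apply: candidates_complete => //; first by move=> b bs _; apply: units_complete => //; apply: le3.
  move=> b g bs; rewrite negb_or -ltnNge => /andP[b11 _] bg; have := s3 bs => bQ.
  have g3 : (3 <= g)%N by rewrite ltnNge; apply/negP => g2; nia.
  have g9 : (9 * g <= Q)%N by nia.
  have : N.of_nat g <= QN / 9 by apply: N.div_le_lower_bound; rewrite /QN; lia.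
  by rewrite mem_range N2Nat.id; move: (QN / 9) => u ug; apply/andP; split; lia.
Qed.

Lemma check_one_sound : 1%N \in s -> (Q < 1000)%N -> check_one QN ->
  exists2 c, c \in s & (rowsum R Q s c < 1)%R.
Proof.
rewrite /check_one => s1 Q1000 /andP[cert chk].
have amin : {in s, forall b, (1 <= b)%N} by move=> b /s0.
apply: (check_min_sound adm s1 _ _ _ chk).
- by left; rewrite muln1 modn_small.
- by apply: candidates_signed_inverse => //; [rewrite muln1 modn_small|exact: units_unit].
- apply: candidates_complete => //.
    move=> b bs bsm; apply: units_complete => //; move: bsm; rewrite /small -mulnn; nia.
  move=> b g bs; rewrite negb_or -ltnNge -leqNgt -mulnn => /andP[b11 bb] bg; have := s3 bs => bQ.
  have g3 : (3 <= g)%N by rewrite ltnNge; apply/negP => g2; nia.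
  have g63 : (g < 63)%N.
    rewrite ltnNge; apply/negP => g63; have b15 : (b <= 15)%N by nia.
    have : (Q <= 256)%N by nia.
    nia.
  by rewrite mem_range; lia.
Qed.

End Complete.

Local Close Scope N_scope.

(** * Estimates on a general row *)

Lemma small_le (Q b c : nat) : (b <= c)%N -> small Q c -> small Q b.
Proof.
rewrite /small -!mulnn => bc /orP[c11|cQ]; apply/orP; [left; lia|].
by case: (leqP b 11) => b11; [left|right]; nia.
Qed.

Lemma small_max (Q : nat) : exists2 t, small Q t & forall b, small Q b -> (b <= t)%N.
Proof.
have ex : exists b, small Q b by exists 0%N.
have bd b : small Q b -> (b <= 11 + Q)%N by rewrite /small -mulnn => /orP[|]; nia.
by case: (ex_maxnP ex bd) => t tsm tmax; exists t.
Qed.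

Lemma sum_affine (R : realType) (u v : R) (n : nat) :
  \sum_(0 <= b < n) (u * b%:R + v) = u * (n%:R * (n%:R - 1) / 2) + v * n%:R.
Proof.
elim: n => [|n IH]; first by rewrite big_geq//; lra.
by rewrite big_nat_recr//= IH -natr1; field.
Qed.

Section Common.
Variables (R : realType) (Q : nat) (s : seq nat).
Hypothesis adm : admissible Q s.
Local Notation q := (Q%:R : R).
Let s0 := adm_gt0 adm.
Let sQ := adm_coprime adm.
Let s3 := adm_lt adm.

Lemma Kd_le_lin (c b : nat) (t : R) : c \in s -> b \in s -> 0 < t -> t <= b%:R * (dist Q c b)%:R ->
  Kd R Q c b <= b%:R / t + 141 / 100 / q.
Proof.
by move=> cs bs; apply: K_le_lin; [apply: (sdist_gt0 adm)|apply: (sdist_le_half adm)].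
Qed.

Lemma Kd_ndvd (c b : nat) : c \in s -> b \in s -> ~~ (b %| c)%N ->
  Kd R Q c b <= b%:R / (q - c%:R) + 141 / 100 / q.
Proof.
move=> cs bs bc; apply: Kd_le_lin => //.
  by rewrite subr_gt0 ltr_nat; have := s3 cs; lia.
by rewrite lerBlDr -natrM -natrD ler_nat (sdist_ndvd adm).
Qed.

Lemma Kd_ndvd2 (c b : nat) : c \in s -> b \in s -> ~~ (b %| c)%N ->
  ~~ (b %| Q - c)%N -> ~~ (b %| Q + c)%N ->
  Kd R Q c b <= b%:R / (2 * q - c%:R) + 141 / 100 / q.
Proof.
move=> cs bs bc bm bp; apply: Kd_le_lin => //.
  by rewrite subr_gt0 -natrM ltr_nat; move: (s3 cs); clear => *; lia.
by rewrite lerBlDr -!natrM -natrD ler_nat (sdist_ndvd2 adm).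
Qed.

(** The case [k = 0]: the distance is at least [D = c / b < Q / 3], and for such [D] the correction
    in [K_le_rational] is at most [99 / 49 * D / Q^2]; [203 / 100] rounds this up. *)
Lemma Kd_dvd (c b : nat) : c \in s -> b \in s -> (b %| c)%N ->
  Kd R Q c b <= b%:R / c%:R + 203 / 100 * (c%:R / b%:R) / q ^+ 2.
Proof.
move=> cs bs bc; have b0 : 0 < b%:R :> R by rewrite ltr0n s0.
have c0 : 0 < c%:R :> R by rewrite ltr0n s0.
set D := c%:R / b%:R : R; have D0 : 0 < D by rewrite divr_gt0.
have b1 : 1 <= b%:R :> R by rewrite ler1n s0.
have c3 : 3 * c%:R < q by rewrite -natrM ltr_nat s3.
have D3 : 3 * D <= q.
  have : D <= c%:R by rewrite /D ler_pdivrMr//; nra.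
  lra.
have q0 : 0 < q by lra.
apply: le_trans (K_le_rational D0 _ (sdist_le_half adm cs bs)) _.
  by rewrite /D ler_pdivrMr// -natrM ler_nat mulnC (sdist_ge adm).
have -> : b%:R / c%:R = 1 / D by rewrite /D; field; rewrite !gt_eqF.
have w0 : 0 < q ^+ 2 - 33 / 20 * D ^+ 2 by nra.
have E (x y : R) : 0 < y -> 0 < x ^+ 2 - 33 / 20 * y ^+ 2 ->
    x ^+ 2 / (y * (x ^+ 2 - 33 / 20 * y ^+ 2)) = 1 / y + 33 / 20 * y / (x ^+ 2 - 33 / 20 * y ^+ 2).
  by move=> y0 xy0; field; rewrite !gt_eqF//=; lra.
rewrite E//.
rewrite lerD2l ler_pdivrMr// [leRHS]mulrAC ler_pdivlMr; last by rewrite exprn_gt0.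
have D9 : D ^+ 2 * 9 <= q ^+ 2 by nra.
have : 0 <= D ^+ 2 by rewrite sqr_ge0.
move: (q ^+ 2) (D ^+ 2) D9 => x y xy y0.
have : 0 <= D * (203 / 100 * (x - 33 / 20 * y) - 33 / 20 * x) by apply: mulr_ge0; lra.
lra.
Qed.

(* Both [b * e] and [c * g] are congruent to [a] up to sign, hence [g * (c / b)] is
   congruent to [e] up to sign. *)
Lemma dual_dist (a b c e g : nat) : a \in s -> b \in s -> c \in s -> ~~ (b %| c)%N ->
  (b * e = Q - a \/ b * e = Q + a)%N -> (c * g = Q - a \/ c * g = Q + a)%N ->
  (Q <= g * dist Q c b + e)%N.
Proof.
have twice (x y : nat) : (y < x)%N -> (2 * y = (x + y) - (x - y))%N by lia.
move=> as_ bs cs bc be cg; have [[a3 b3] c3] := (s3 as_, s3 bs, s3 cs).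
have [[a0 b0] c0] := (s0 as_, s0 bs, s0 cs).
have Q1 : (1 < Q)%N by lia.
have cQ : (c < Q)%N by lia.
have aQ : (a < Q)%N by lia.
have b2 : (2 <= b)%N by case: (leqP b 1) => // b1; rewrite (_ : b = 1)%N ?dvd1n// in bc; lia.
have [_ [k kE]] := distP Q1 (sQ bs) cQ; set d := dist Q c b in kE *.
have g2 : (2 < g)%N by rewrite ltnNge; apply/negP => g2; nia.
(* If [d g = e] and [b e = c g], then [c = b d], against [~~ (b %| c)]. If the signs differ, [g]
   divides both [Q - a] and [Q + a], hence [2 a]; being coprime to [a] it divides 2, against
   [2 < g]. *)
have neq : (d * g != e)%N.
  apply/eqP => dge.
  have [same|diff] := boolP (b * e == c * g)%N.
    have : (c = b * d)%N by move: same => /eqP; rewrite -dge; nia.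
    by move=> cE; rewrite cE dvdn_mulr in bc.
  have g2a : (g %| 2 * a)%N.
    have g1 : (g %| b * e)%N by rewrite -dge mulnA dvdn_mull.
    have g1' : (g %| c * g)%N by rewrite dvdn_mull.
    rewrite (twice _ _ aQ).
    by move: diff g1 g1'; case: be => ->; case: cg => ->; rewrite ?eqxx// => _ *; apply: dvdn_sub.
  have cga : coprime g a.
    rewrite /coprime -dvdn1 -(eqP (sQ as_)) dvdn_gcd dvdn_gcdr/=.
    have ga := dvdn_gcdr g a.
    have gn : (gcdn g a %| c * g)%N by rewrite dvdn_mull// dvdn_gcdl.
    case: cg gn => ->; last by rewrite dvdn_addl.
    by rewrite -(dvdn_addl _ ga) subnK// ltnW.
  move: g2a; rewrite Gauss_dvdl// => /(dvdn_leq (ltn0Sn 1)).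
  lia.
have eQ : (e < Q)%N.
  have : (2 * e <= b * e)%N by rewrite leq_mul2r b2 orbT.
  by move: be a3; move: (b * e)%N => x; clear => *; lia.
(* The three congruences give [b (d g) = b e] up to sign modulo [Q], and [b] cancels. As [d g] is
   positive and differs from [e], it is then at least [Q - e]. *)
have key : (Q %| d * g + (Q - e))%N \/ (Q %| d * g + e)%N.
  have cbQ : coprime Q b by rewrite coprime_sym sQ.
  have H : (Q %| b * (d * g + (Q - e)))%N \/ (Q %| b * (d * g + e))%N.
    have E1 : (b * (d * g + (Q - e)) + b * e = b * d * g + b * Q)%N.
      by rewrite -mulnDr -addnA subnK ?(ltnW eQ)// mulnDr mulnA.
    have E2 : (b * (d * g + e) = b * d * g + b * e)%N by rewrite mulnDr mulnA.
    have YZ : (c * g = b * e)%N \/ (c * g + b * e = 2 * Q)%N by lia.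
    have XZ : (b * d * g = k * g * Q + c * g)%N \/ (b * d * g + c * g = k * g * Q)%N.
      by case: kE => kE; [left; rewrite kE mulnDl mulnAC|right; rewrite -mulnDl kE mulnAC].
    move: E1 E2 XZ YZ; move: (b * d * g)%N (b * e)%N (c * g)%N (k * g)%N => X Y Z W.
    move: (b * (d * g + (Q - e)))%N (b * (d * g + e))%N => U V UE VE.
    move=> [] XE [] YE.
    - by left; apply/dvdnP; exists (W + b)%N; lia.
    - by right; apply/dvdnP; exists (W + 2)%N; lia.
    - by right; apply/dvdnP; exists W; lia.
    - by left; apply/dvdnP; exists (W + b - 2)%N; rewrite mulnBl mulnDl; lia.
  by case: H; rewrite Gauss_dvdr//; [left|right].
have dg0 : (0 < d * g)%N.
  by rewrite muln_gt0 (sdist_gt0 adm)//; lia.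
rewrite mulnC; move: neq eQ dg0 key; move: (d * g)%N => X; clear => neq eQ X0.
case=> /dvdnP[[|t] tE].
- by clear -tE eQ; lia.
- case: t tE => [|t] tE; first by case/eqP: neq; clear -tE eQ; lia.
  by clear -tE; nia.
- by clear -tE X0; lia.
- by clear -tE; nia.
Qed.

End Common.

(** * Least element at least 2 *)

Lemma not_small_ge34 (Q c : nat) : (300 <= Q)%N -> (4 * Q <= c ^ 2)%N ->
  (34 <= c)%N && ~~ small Q c.
Proof.
rewrite /small negb_or -ltnNge -leqNgt -!mulnn => Q300 cQ.
have c34 : (34 <= c)%N by nia.
by rewrite c34 (leq_trans _ c34)//=; nia.
Qed.

(** The left side is the sum of [111 / 100 b + 141 / 100] over all [b <= x], the worst case for
    small multiples of [a]. The right side is what [39 / 100 (Q - c)] leaves free below [Q] when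
    [c >= 34]. *)
Lemma small_affine_lt (R : realType) (x q : R) : 300 <= q -> 0 <= x ->
  (x <= 11) || (16 * (x - 11) ^+ 2 < q) ->
  111 / 100 * ((x + 1) * (x + 1 - 1) / 2) + 141 / 100 * (x + 1) < 61 / 100 * q + 13.
Proof.
move=> q300 x0 /orP[x11|xq].
  have : 0 <= x * (11 - x) by rewrite mulr_ge0// subr_ge0.
  by lra.
have : 0 <= (x - 11 - 164 / 100) ^+ 2 by rewrite sqr_ge0.
by lra.
Qed.

Lemma small_real (R : realType) (Q t : nat) : small Q t ->
  ((t%:R : R) <= 11) || (16 * (t%:R - 11) ^+ 2 < Q%:R :> R).
Proof.
rewrite (ler_nat R t 11) /small => /orP[->//|tQ].
case: (leqP t 11) => //= t11.
by move: tQ; rewrite -(ltr_nat R) natrM natrX natrB// ltnW.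
Qed.

Section Big.
Variables (R : realType) (Q : nat) (s : seq nat) (a : nat).
Hypothesis adm : admissible Q s.
Hypotheses (as_ : a \in s) (amin : {in s, forall b, (a <= b)%N}).
Local Notation q := (Q%:R : R).
Let us := adm_uniq adm.
Let s0 := adm_gt0 adm.
Let sQ := adm_coprime adm.
Let s3 := adm_lt adm.

Let p : R := q - a%:R.

Lemma Q_sub_gt0 : 0 < p.
Proof. by rewrite subr_gt0 ltr_nat; have := s3 as_; lia. Qed.

Lemma Q_sub_le : p <= q.
Proof. by rewrite /p gerBl. Qed.

Lemma min_row_le (b : nat) : b \in s -> b != a -> p * Kd R Q a b <= b%:R + excess b%:R.
Proof.
move=> bs ba; rewrite mulrC -ler_pdivlMr ?Q_sub_gt0//.
exact: (Kd_le_excess R adm as_ bs (min_ndvd adm as_ amin bs ba)).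
Qed.

Lemma min_row_le_far (b : nat) : b \in s -> b != a -> ~~ (b %| Q - a)%N -> ~~ (b %| Q + a)%N ->
  p * Kd R Q a b <= b%:R / 2 + 141 / 100.
Proof.
move=> bs ba bm bp; rewrite mulrC -ler_pdivlMr ?Q_sub_gt0//.
exact: (Kd_le_far R adm as_ bs (min_ndvd adm as_ amin bs ba)).
Qed.

(** Multiplying by [p] clears the denominator of row [a]; the numerical bound [u] of [p / (Q - c)]
    is supplied by the caller so that later goals stay linear. *)
Lemma row_le_ndvd (c b : nat) (u : R) : c \in s -> b \in s -> ~~ (b %| c)%N ->
  p <= u * (q - c%:R) -> p * Kd R Q c b <= u * b%:R + 141 / 100.
Proof.
move=> cs bs bc pu.
have qc : 0 < q - c%:R by rewrite subr_gt0 ltr_nat; have := s3 cs; lia.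
have q0 : 0 < q by apply: lt_le_trans Q_sub_gt0 Q_sub_le.
have p0 := Q_sub_gt0; have pq := Q_sub_le.
apply: le_trans (ler_wpM2l (ltW p0) (Kd_ndvd R adm cs bs bc)) _.
have -> : p * (b%:R / (q - c%:R) + 141 / 100 / q) =
    b%:R * p / (q - c%:R) + 141 / 100 * p / q by field; rewrite !gt_eqF.
apply: lerD; rewrite ler_pdivrMr//; last by lra.
by rewrite -[leRHS]mulrA [leRHS]mulrCA ler_wpM2l.
Qed.

Lemma row_le_far (c b : nat) (u : R) : c \in s -> b \in s -> ~~ (b %| c)%N ->
  ~~ (b %| Q - c)%N -> ~~ (b %| Q + c)%N ->
  p <= u * (2 * q - c%:R) -> p * Kd R Q c b <= u * b%:R + 141 / 100.
Proof.
move=> cs bs bc bm bp pu.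
have qc : 0 < 2 * q - c%:R by rewrite subr_gt0 -natrM ltr_nat; move: (s3 cs); clear => *; lia.
have q0 : 0 < q by apply: lt_le_trans Q_sub_gt0 Q_sub_le.
have p0 := Q_sub_gt0; have pq := Q_sub_le.
apply: le_trans (ler_wpM2l (ltW p0) (Kd_ndvd2 R adm cs bs bc bm bp)) _.
have -> : p * (b%:R / (2 * q - c%:R) + 141 / 100 / q) =
    b%:R * p / (2 * q - c%:R) + 141 / 100 * p / q by field; rewrite !gt_eqF.
apply: lerD; rewrite ler_pdivrMr//; last by lra.
by rewrite -[leRHS]mulrA [leRHS]mulrCA ler_wpM2l.
Qed.

Lemma weighted_split (c : nat) : c \in s -> c != a ->
  2 * rowsum R Q s a + rowsum R Q s c = 2 * Kd R Q a c + Kd R Q c a +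
    \sum_(b <- s | (b != a) && (b != c)) (2 * Kd R Q a b + Kd R Q c b).
Proof.
move=> cs ca; have ac : a != c by rewrite eq_sym.
rewrite /rowsum (bigD1_seq_cond _ us cs ca) (bigD1_seq_cond (P := fun b => b != c) _ us as_ ac).
rewrite big_split/= -(mulr_sumr _ _ (fun b => Kd R Q a b)).
rewrite (eq_bigl (fun b => (b != a) && (b != c)) (fun b => Kd R Q c b)); last by move=> b; rewrite andbC.
by ring.
Qed.

Lemma sum_rest (c : nat) : c \in s -> c != a ->
  \sum_(b <- s | (b != a) && (b != c)) b%:R <= p - c%:R.
Proof.
move=> cs ca; have := sum_others_real R adm as_.
by rewrite (bigD1_seq_cond _ us cs ca)/= -/p; lra.
Qed.

Section Multiples.
Hypothesis f1 : 1 <= rowsum R Q s a.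
Variable c : nat.
Hypotheses (a2 : (2 <= a)%N) (Q300 : (300 <= Q)%N).
Hypotheses (cs : c \in s) (ac : ~~ (a %| c)%N).
Hypothesis cmin : {in s, forall b, ~~ (a %| b)%N -> (c <= b)%N}.

Let ca : c != a. Proof. by apply: contraNneq ac => ->. Qed.
Let acl : (a < c)%N. Proof. by have := amin cs; rewrite leq_eqVlt eq_sym (negbTE ca). Qed.
Let q300 : 300 <= q. Proof. by rewrite ler_nat. Qed.
Let three_mul_lt : 3 * c%:R < q. Proof. by rewrite -natrM ltr_nat s3. Qed.
Let acR : a%:R + 1 <= c%:R :> R. Proof. by rewrite natr1 ler_nat. Qed.
Let a2R : 2 <= a%:R :> R. Proof. by rewrite ler_nat. Qed.

(** A divisor of [c] other than [c] is smaller, hence a multiple of [a], which would make [c] one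
    too. This removes the terms with [k = 0] from row [c]. *)
Lemma first_nonmultiple_ndvd (b : nat) : b \in s -> b != c -> ~~ (b %| c)%N.
Proof.
move=> bs bc; apply/negP => bdc.
have [ab|/(cmin bs) cb] := boolP (a %| b)%N; first by move: (dvdn_trans ab bdc); rewrite (negbTE ac).
by move: bc; rewrite eqn_leq cb (dvdn_leq (s0 cs) bdc).
Qed.

(** Otherwise [a] would divide [Q], while it is coprime to [Q] and at least 2. *)
Lemma multiple_far (b : nat) : b \in s -> (a %| b)%N -> ~~ (b %| Q - a)%N /\ ~~ (b %| Q + a)%N.
Proof.
move=> bs ab; have aQ : (a < Q)%N by have := s3 as_; clear; lia.
have naQ : ~~ (a %| Q)%N.
  apply/negP => aQd; have := sQ as_; rewrite /coprime (gcdn_idPl aQd) => /eqP a1.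
  by move: a2; rewrite a1.
split; apply: contra naQ => /(dvdn_trans ab).
  by rewrite -{2}(subnK (ltnW aQ)) dvdn_addl.
by rewrite dvdn_addl.
Qed.

Lemma multiple_small (b : nat) : b \in s -> (a %| b)%N -> b != a -> small Q b.
Proof.
move=> bs ab ba; apply: contraT => nsm; have [bm bp] := multiple_far bs ab.
by have := large_dvd adm as_ amin f1 bs ba nsm; rewrite (negbTE bm) (negbTE bp).
Qed.

Lemma rowsum_large_nonmultiple_lt : (4 * Q <= c ^ 2)%N -> rowsum R Q s c < 1.
Proof.
move=> cQ.
have cR : 4 * q <= c%:R ^+ 2 by rewrite -natrX -natrM ler_nat.
have /andP[c34 nsc] := not_small_ge34 Q300 cQ.
have c35 : 34 <= c%:R :> R by rewrite ler_nat.
have [q3 c3 ac1 a2r] : [/\ 300 <= q, 3 * c%:R < q, a%:R + 1 <= c%:R :> R & 2 <= a%:R :> R] by [].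
have q0 : 0 < q by lra.
have p0 := Q_sub_gt0; have pq := Q_sub_le.
have [g gE] : exists g, (c * g = Q - a \/ c * g = Q + a)%N.
  by have /orP[/dvdnP[g E]|/dvdnP[g E]] := large_dvd adm as_ amin f1 cs ca nsc;
    exists g; rewrite mulnC; [left|right].
(* By [dual_dist] the term is about [g / (Q - e)]. Here [g <= 4 Q / (3 c) <= c / 3] because
   [c^2 >= 4 Q], and [e <= 4 Q / 100] because [b >= c >= 34]. *)
have big b : b \in s -> ~~ (a %| b)%N -> b != c -> q * Kd R Q c b <= 39 / 100 * b%:R.
  move=> bs ab bc; have ba : b != a by apply: contraNneq ab => ->.
  have cb := cmin bs ab.
  have nsb : ~~ small Q b by apply: contra nsc; apply: small_le.
  have [e eE] : exists e, (b * e = Q - a \/ b * e = Q + a)%N.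
    by have /orP[/dvdnP[e E]|/dvdnP[e E]] := large_dvd adm as_ amin f1 bs ba nsb;
      exists e; rewrite mulnC; [left|right].
  have := dual_dist adm as_ bs cs (first_nonmultiple_ndvd bs bc) eE gE.
  rewrite -(ler_nat R) natrD natrM => ddist.
  have cbR : c%:R <= b%:R :> R by rewrite ler_nat.
  have gR : c%:R * g%:R <= 4 / 3 * q.
    have : (c * g <= Q + a)%N by case: gE => ->; clear; lia.
    by rewrite -(ler_nat R) natrM natrD; lra.
  have eR : c%:R * e%:R <= 4 / 3 * q.
    have : (b * e <= Q + a)%N by case: eE => ->; clear; lia.
    have : c%:R * e%:R <= b%:R * e%:R :> R by rewrite ler_wpM2r.
    by rewrite -(ler_nat R) natrM natrD; lra.
  have e0 : 0 <= e%:R :> R by [].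
  have g0 : 0 <= g%:R :> R by [].
  have eq : e%:R <= 4 / 100 * q by nra.
  have qe : 0 < q - e%:R by lra.
  have := K_le_lin (sdist_gt0 adm cs bs) (sdist_le_half adm cs bs) qe; rewrite -/(Kd R Q c b).
  move=> /(_ g ltac:(lra)) Kb.
  have gqe : g%:R / (q - e%:R) <= g%:R / (96 / 100 * q).
    by rewrite ler_wpM2l// lef_pV2 ?posrE; lra.
  have : q * Kd R Q c b <= 25 / 24 * g%:R + 141 / 100.
    have -> : 25 / 24 * g%:R + 141 / 100 = q * (g%:R / (96 / 100 * q) + 141 / 100 / q).
      by field; rewrite gt_eqF.
    by rewrite ler_pM2l//; lra.
  suff : 25 / 24 * g%:R + 141 / 100 <= 39 / 100 * c%:R :> R.
    by lra.
  have gc : g%:R <= c%:R / 3 :> R by nra.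
  by lra.
(* [39 / 100 + 111 / 100 = 3 / 2] bounds [Q / (Q - c)], as [3 c < Q]. The surplus is affordable
   since multiples of [a] other than [a] are small. *)
have mult b : b \in s -> (a %| b)%N -> b != c ->
    q * Kd R Q c b <= 39 / 100 * b%:R + (111 / 100 * b%:R + 141 / 100).
  move=> bs ab bc.
  have qc : 0 < q - c%:R by lra.
  apply: le_trans (ler_wpM2l (ltW q0) (Kd_ndvd R adm cs bs (first_nonmultiple_ndvd bs bc))) _.
  have -> : q * (b%:R / (q - c%:R) + 141 / 100 / q) = b%:R * q / (q - c%:R) + 141 / 100.
    by field; rewrite !gt_eqF.
  rewrite addrA lerD2r ler_pdivrMr//.
  have : 0 <= b%:R * (q - 3 * c%:R) by rewrite mulr_ge0// subr_ge0 ltW.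
  by lra.
have tot : q * rowsum R Q s c <= 39 / 100 * (q - c%:R) +
    \sum_(b <- s | (b != c) && (a %| b)%N) (111 / 100 * b%:R + 141 / 100).
  apply: (@le_trans _ _ (\sum_(b <- s | b != c) (39 / 100 * b%:R +
     (if (a %| b)%N then 111 / 100 * b%:R + 141 / 100 else 0)))).
    rewrite mulr_sumr big_seq_cond [leRHS]big_seq_cond; apply: ler_sum => b /andP[bs bc].
    by case: ifPn => ab; [apply: mult|rewrite addr0; apply: big].
  rewrite big_split/= -mulr_sumr -big_mkcondr/= lerD2r.
  by have := sum_others_real R adm cs; lra.
suff small_part : \sum_(b <- s | (b != c) && (a %| b)%N) (111 / 100 * b%:R + 141 / 100) <
    61 / 100 * q + 13 :> R.
  by rewrite -(ltr_pM2l q0) mulr1; lra.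
(* [a] itself need not be small; if it is not, no other multiple of [a] occurs. *)
have [sma|nsma] := boolP (small Q a); last first.
  have -> : \sum_(b <- s | (b != c) && (a %| b)%N) (111 / 100 * b%:R + 141 / 100) =
      111 / 100 * a%:R + 141 / 100 :> R.
    rewrite (bigD1_seq_cond _ us as_)/=; last by rewrite eq_sym ca dvdnn.
    rewrite big_seq_cond big_pred0 ?addr0// => b; apply/negP => /andP[bs /andP[/andP[bc ab] ba]].
    by have := small_le (amin bs) (multiple_small bs ab ba); rewrite (negbTE nsma).
  have : 3 * a%:R < q by rewrite -natrM ltr_nat s3.
  by lra.
have [t tsm tmax] := small_max Q.
apply: (@le_lt_trans _ _ (\sum_(0 <= b < t.+1) (111 / 100 * b%:R + 141 / 100))).
  apply: ler_sum_sub => // [b bs /andP[bc ab]|b _].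
    rewrite mem_index_iota ltnS/=; apply: tmax.
    by have [->//|ba] := eqVneq b a; apply: multiple_small.
  by have : 0 <= b%:R :> R by []; lra.
rewrite sum_affine -(natr1 t).
exact: small_affine_lt q3 (ler0n _ _) (small_real R tsm).
Qed.

End Multiples.
End Big.

Lemma excess_ge3 (R : realType) (x : R) : 3 <= x -> excess x <= 68 / 100.
Proof.
move=> x3; apply: le_trans (excess_anti _ x3) _; first by lra.
by rewrite /excess ler_pdivrMr; lra.
Qed.

(** From 13 on, the margin [13 / 100 b] between [254 / 100] and [267 / 100] covers [141 / 100] and
    two excesses; below 13 the slack makes up the difference. *)
Lemma near_slack_ge2 (R : realType) (b : nat) : (4 <= b)%N ->
  2 * (b%:R + excess b%:R) + (54 / 100 * b%:R + 141 / 100) <=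
  267 / 100 * b%:R + (if (b < 13)%N then 35 / 10 - 27 / 100 * b%:R else 0) :> R.
Proof.
move=> b4.
have lo n : (n <= b)%N -> (n%:R : R) <= b%:R by rewrite ler_nat.
have hi n : (b <= n)%N -> b%:R <= (n%:R : R) by rewrite ler_nat.
have mono n : (2 <= n)%N -> (n <= b)%N -> excess (b%:R : R) <= excess n%:R.
  by move=> n2 nb; apply: excess_anti; rewrite ler_nat.
have x4 : excess (4%:R : R) <= 46 / 100 by rewrite /excess ler_pdivrMr; lra.
have x8 : excess (8%:R : R) <= 22 / 100 by rewrite /excess ler_pdivrMr; lra.
have x12 : excess (12%:R : R) <= 14 / 100 by rewrite /excess ler_pdivrMr; lra.
have x13 : excess (13%:R : R) <= 13 / 100 by rewrite /excess ler_pdivrMr; lra.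
case: ifPn => [b13|]; last first.
  by rewrite -leqNgt => b13; have := mono 13 isT b13; have := lo _ b13; lra.
have [b8|b8] := ltnP b 8.
  by have := mono 4 isT b4; have := hi 7 b8; lra.
have [b12|b12] := ltnP b 12.
  by have := mono 8 isT b8; have := hi 11 b12; lra.
by have := mono 12 isT b12; have := hi 12 b13; lra.
Qed.

Lemma sqr_lt_lin300 (R : realType) (x q : R) : 0 <= x -> 300 <= q -> x ^+ 2 < 4 * q ->
  x <= 12 / 100 * q.
Proof.
move=> x0 q300 xq; rewrite leNgt; apply/negP => h.
have : (12 / 100 * q) * (12 / 100 * q) <= x * x by apply: ler_pM; lra.
by nra.
Qed.

(** A common divisor of [Q +- a] and [Q +- c] divides [c - a] or [c + a]; both are positive and
    below [2 b], and the first is below [b], so only [b = a + c] is possible. *)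
Lemma common_dvd (Q a b c : nat) : (c < Q)%N -> (a < c < b)%N -> b != (a + c)%N ->
  (b %| Q - a)%N || (b %| Q + a)%N -> ~~ (b %| Q - c)%N /\ ~~ (b %| Q + c)%N.
Proof.
move=> cQ /andP[ac cb] bac.
have [E1 E2 E3 E4] : [/\ Q - a - (Q - c) = c - a, Q + c - (Q - a) = a + c,
    Q + a - (Q - c) = a + c & Q + c - (Q + a) = c - a]%N.
  by clear bac; split; lia.
have diff : ~~ (b %| c - a)%N.
  by apply/negP => /(dvdn_leq _); rewrite subn_gt0 => /(_ ac) h; lia.
have sum : ~~ (b %| a + c)%N.
  by apply: contra bac => /dvdnP[[|[|k]] h]; apply/eqP; lia.
case/orP => ba; split; [apply: contra diff|apply: contra sum|apply: contra sum|apply: contra diff] => h.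
- by rewrite -E1 dvdn_sub.
- by rewrite -E2 dvdn_sub.
- by rewrite -E3 dvdn_sub.
- by rewrite -E4 dvdn_sub.
Qed.

Section Min.
Variables (R : realType) (Q : nat) (s : seq nat) (a : nat).
Hypothesis adm : admissible Q s.
Hypotheses (as_ : a \in s) (amin : {in s, forall b, (a <= b)%N}).
Hypotheses (a2 : (2 <= a)%N) (Q300 : (300 <= Q)%N).
Local Notation q := (Q%:R : R).
Local Notation p := (q - a%:R : R).

Lemma two_rowsums_nonmultiple_lt (c : nat) : c \in s -> ~~ (a %| c)%N ->
  {in s, forall b, ~~ (a %| b)%N -> (c <= b)%N} -> (c ^ 2 < 4 * Q)%N ->
  2 * rowsum R Q s a + rowsum R Q s c < 3.
Proof.
move=> cs ac cmin cQ.
have ca : c != a by apply: contraNneq ac => ->.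
have acl : (a < c)%N by have := amin cs; rewrite leq_eqVlt eq_sym (negbTE ca).
have q300 : 300 <= q by rewrite ler_nat.
have acR : a%:R + 1 <= c%:R :> R by rewrite natr1 ler_nat.
have a2R : 2 <= a%:R :> R by rewrite ler_nat.
have cR : c%:R ^+ 2 < 4 * q by rewrite -natrX -natrM ltr_nat.
have c12 : c%:R <= 12 / 100 * q by apply: sqr_lt_lin300.
have pq := Q_sub_le R Q a.
have p0 : 0 < p := Q_sub_gt0 R adm as_.
(* As [c <= 12 / 100 Q], row [c] costs [114 / 100 b] in general and [54 / 100 b] when [k >= 2]. The
   exceptional [b = a + c] pays the difference [6 / 10 b]. *)
have Wb (b : nat) : b \in s -> b != a -> b != c -> p * (2 * Kd R Q a b + Kd R Q c b) <=
    267 / 100 * b%:R + (if (b < 13)%N then 35 / 10 - 27 / 100 * b%:R else 0) +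
    (if b == (a + c)%N then 6 / 10 * b%:R else 0).
  move=> bs ba bc; have bdc := first_nonmultiple_ndvd adm cs ac cmin bs bc.
  have b0 : 0 <= b%:R :> R by [].
  have ab : (a < b)%N by have := amin bs; rewrite leq_eqVlt eq_sym (negbTE ba).
  have x0 : 0 <= (if b == (a + c)%N then 6 / 10 * b%:R else 0) :> R by case: ifP => _; lra.
  have Kc := @row_le_ndvd R Q s a adm as_ c b (114 / 100) cs bs bdc.
  have {}Kc := Kc ltac:(lra).
  have [nb|] := boolP ((b %| Q - a)%N || (b %| Q + a)%N); last first.
    rewrite negb_or => /andP[bm bp].
    have Ka := min_row_le_far R adm as_ amin bs ba bm bp.
    have b3 : 3 <= b%:R :> R by rewrite ler_nat (leq_ltn_trans a2).
    apply: ler_wpDr => //; have [b13|b13] := ltnP b 13; first by lra.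
    have b13R : 13 <= b%:R :> R by rewrite ler_nat.
    by lra.
  have Ka := min_row_le R adm as_ amin bs ba.
  have nab : ~~ (a %| b)%N.
    apply/negP => /(multiple_far adm as_ a2 bs)[bm bp].
    by move: nb; rewrite (negbTE bm) (negbTE bp).
  have cb : (c < b)%N by rewrite ltn_neqAle eq_sym bc cmin.
  have b4 : (4 <= b)%N by apply: leq_ltn_trans cb; apply: leq_ltn_trans acl.
  have nw := near_slack_ge2 R b4.
  case: (eqVneq b (a + c)%N) => [bac|bac].
    move: nw; case: ifP => _ nw; lra.
  rewrite addr0.
  suff Kc' : p * Kd R Q c b <= 54 / 100 * b%:R + 141 / 100 by move: nw; case: ifP => _ nw; lra.
  have [h1 h2] : ~~ (b %| Q - c)%N /\ ~~ (b %| Q + c)%N.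
    by apply: (common_dvd _ _ bac nb); [have := adm_lt adm cs; clear; lia|rewrite acl].
  apply: (row_le_far adm as_ cs bs bdc h1 h2); lra.
have := weighted_split R adm as_ cs ca.
have Kac := min_row_le R adm as_ amin cs ca.
have xc : excess (c%:R : R) <= 68 / 100 by apply: excess_ge3; lra.
have acd : ~~ (a %| c)%N by [].
have Kca := @row_le_ndvd R Q s a adm as_ c a (114 / 100) cs as_ ac ltac:(lra).
have y0 : \sum_(b <- s | (b != a) && (b != c))
    (if (b < 13)%N then 35 / 10 - 27 / 100 * b%:R else 0) <= 1475 / 100 :> R.
  apply: (@le_trans _ _ (\sum_(3 <= b < 13) (35 / 10 - 27 / 100 * b%:R))).
    apply: ler_sum_window; first exact: adm_uniq adm.
      move=> b bs /andP[ba _]; have := amin bs; rewrite leq_eqVlt eq_sym (negbTE ba)/=.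
      exact: leq_ltn_trans.
    move=> b /andP[_ b13]; have : b%:R <= 12 :> R by rewrite ler_nat.
    lra.
  by do 10 rewrite big_ltn//; rewrite big_geq//; lra.
have e0 : \sum_(b <- s | (b != a) && (b != c)) (if b == (a + c)%N then 6 / 10 * b%:R else 0)
   <= 6 / 10 * (a%:R + c%:R) :> R.
  rewrite -big_mkcondr/= -natrD.
  apply: le_trans (@ler_sum_sub _ s [:: (a + c)%N] _ _ (adm_uniq adm) _ _) _; last by rewrite big_seq1.
    by move=> b _ /andP[_ /eqP->]; rewrite mem_seq1.
  by move=> b _; rewrite mulr_ge0// divr_ge0.
have sb := sum_rest R adm as_ cs ca.
have tot : p * (\sum_(b <- s | (b != a) && (b != c)) (2 * Kd R Q a b + Kd R Q c b)) <=
    267 / 100 * (p - c%:R) + 1475 / 100 + 6 / 10 * (a%:R + c%:R).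
  apply: le_trans (_ : \sum_(b <- s | (b != a) && (b != c)) (267 / 100 * b%:R +
    (if (b < 13)%N then 35 / 10 - 27 / 100 * b%:R else 0) +
    (if b == (a + c)%N then 6 / 10 * b%:R else 0)) <= _).
    rewrite mulr_sumr big_seq_cond [leRHS]big_seq_cond; apply: ler_sum => b /and3P[bs ba bc].
    exact: Wb.
  by rewrite !big_split/= -mulr_sumr; lra.
move=> E; rewrite -(ltr_pM2l p0) E.
have : 0 <= (c%:R - 35) ^+ 2 :> R by rewrite sqr_ge0.
lra.
Qed.
(** By [multiple_far] every other element contributes only about half of its weight. *)
Lemma rowsum_multiples_lt : {in s, forall b, (a %| b)%N} -> rowsum R Q s a < 1.
Proof.
move=> sa; have p0 : 0 < p := Q_sub_gt0 R adm as_.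
have q300 : 300 <= q by rewrite ler_nat.
have a3 : 3 * a%:R < q by rewrite -natrM ltr_nat (adm_lt adm).
set n : R := (size s)%:R.
have n2 : n ^+ 2 <= 2 * q.
  rewrite /n -natrX -natrM ler_nat.
  apply: leq_trans (sqr_size_le (adm_uniq adm) (adm_gt0 adm)) _.
  by rewrite leq_mul2l adm_sum.
have tot : p * rowsum R Q s a <= p / 2 + 141 / 100 * n.
  apply: le_trans (_ : \sum_(b <- s | b != a) (b%:R / 2 + 141 / 100) <= _).
    rewrite mulr_sumr big_seq_cond [leRHS]big_seq_cond; apply: ler_sum => b /andP[bs ba].
    have [bm bp] := multiple_far adm as_ a2 bs (sa _ bs).
    exact: (min_row_le_far R adm as_ amin bs ba bm bp).
  rewrite big_split/= -mulr_suml; apply: lerD.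
    by rewrite ler_pM2r ?invr_gt0// sum_others_real.
  by rewrite big_const_seq iter_addr_0 -[leLHS]mulr_natr ler_wpM2l ?divr_ge0// ler_nat count_size.
rewrite -(ltr_pM2l p0) mulr1; apply: le_lt_trans tot _.
have : 0 <= (n - 24) ^+ 2 by rewrite sqr_ge0.
lra.
Qed.

Lemma exists_row_min_ge2 : exists2 c, c \in s & rowsum R Q s c < 1.
Proof.
have [f1|f1] := ltP (rowsum R Q s a) 1; first by exists a.
have [/allP sa|] := boolP (all (fun b => a %| b)%N s).
  by have := rowsum_multiples_lt sa; exists a.
rewrite -has_predC => /hasP[c0 c0s c0a].
have ex : exists c, (c \in s) && ~~ (a %| c)%N by exists c0; rewrite c0s.
case: (ex_minnP ex) => c /andP[cs ac] cmin.
have cmin' : {in s, forall b, ~~ (a %| b)%N -> (c <= b)%N}.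
  by move=> b bs ab; apply: cmin; rewrite bs.
exists c => //.
have [cQ|cQ] := leqP (4 * Q) (c ^ 2); first exact: (rowsum_large_nonmultiple_lt adm as_ amin f1 a2 Q300 cs ac cmin').
by have := two_rowsums_nonmultiple_lt cs ac cmin' cQ; lra.
Qed.

End Min.

(** * Least element 1 *)

Lemma sum_pow2_inv_le (R : realFieldType) (s : seq nat) (P : pred nat) : uniq s ->
  {in s, forall b, P b -> pow2 b} -> \sum_(b <- s | P b) b%:R^-1 <= 2 :> R.
Proof.
move=> us sP; pose n := (\max_(b <- s) trunc_log 2 b).+1.
apply: le_trans (@ler_sum_sub _ s [seq (2 ^ i)%N | i <- iota 0 n] P _ us _ _) _.
- move=> b bs /(sP _ bs)/eqP bE; apply/mapP; exists (trunc_log 2 b) => //.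
  by rewrite mem_iota ltnS leq_bigmax_seq.
- by move=> b _; rewrite invr_ge0.
rewrite big_map (_ : iota 0 n = index_iota 0 n); last by rewrite /index_iota subn0.
have E k : \sum_(0 <= i < k) (2 ^ i)%:R^-1 = 2 - 2 * (2 ^ k)%:R^-1 :> R.
  elim: k => [|k IH]; first by rewrite big_geq// expn0; lra.
  rewrite big_nat_recr//= IH expnS natrM invfM.
  by field; rewrite pnatr_eq0 expn_eq0.
by rewrite E gerBl mulr_ge0 ?invr_ge0.
Qed.

(** Powers of 2 dividing [c] take a share of about [2 / m] of row [c]; hence the later distinction
    between [m = 3] and [m >= 5]. *)
Lemma pow2_part (c : nat) : (0 < c)%N -> ~~ pow2 c -> exists D m,
  [/\ c = (D * m)%N, pow2 D, odd m, (3 <= m)%N &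
    forall b, pow2 b -> (b %| c)%N = (b %| D)%N].
Proof.
move=> c0 cp; have [m co cE] := pfactor_coprime (isT : prime 2) c0.
exists (2 ^ logn 2 c)%N, m; rewrite mulnC -cE coprime2n in co *.
split=> //.
- by apply/pow2P; eexists.
- case: m co cE => [|[|[|m]]]// _; rewrite mul1n => cE.
  by move: cp; rewrite cE => /negP[]; apply/pow2P; eexists.
move=> b /pow2P[i ->]; rewrite pfactor_dvdn//.
by rewrite dvdn_Pexp2l.
Qed.

Lemma pow2_between (D b : nat) : pow2 D -> pow2 b -> ~~ (b %| D)%N -> (b < D * 3)%N ->
  b = (2 * D)%N.
Proof.
move=> /pow2P[l ->] /pow2P[i ->]; rewrite dvdn_Pexp2l// -ltnNge => li.
rewrite -(subnKC li) expnD expnS; move: (i - l.+1)%N => [|k]; rewrite ?muln1// expnS.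
by have := expn_gt0 2 k; nia.
Qed.

(** Modulo [b], [Q] is 1 or -1, so [b d = k Q +- c] reduces to [k = +- c]. *)
Lemma dvdn_near (Q b c d k : nat) : (k < c)%N -> (c < Q)%N ->
  (b %| Q - 1)%N || (b %| Q + 1)%N -> (b * d = k * Q + c \/ b * d + c = k * Q)%N ->
  (b %| c + k)%N || (b %| c - k)%N.
Proof.
move=> kc cQ bQ dk.
have [x [xb xk]] : exists x, (b %| x)%N /\ (x = k * Q - k \/ x = k * Q + k)%N.
  by case/orP: bQ => /(dvdn_mull k); rewrite ?mulnBr ?mulnDr muln1 => h;
    eexists; split; [exact: h|left|exact: h|right].
have kQ : (k <= k * Q)%N by rewrite leq_pmulr// (leq_ltn_trans _ cQ).
have : (b %| b * d)%N := dvdn_mulr _ (dvdnn b).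
move: (k * Q)%N (b * d)%N kQ dk xk => w u kw uw xw bu.
have [E|[E|[E|E]]] : (c + k = u - x \/ c - k = u - x \/ c - k = x - u \/ c + k = x - u)%N.
  by clear -kc uw xw kw; lia.
all: by apply/orP; rewrite E; solve [left; exact: dvdn_sub|right; exact: dvdn_sub].
Qed.

Section NearMultiples.
Variables (R : realType) (Q : nat) (s : seq nat).
Hypothesis adm : admissible Q s.
Local Notation q := (Q%:R : R).
Local Notation p := (q - 1%:R : R).

Lemma one_min : {in s, forall b, (1 <= b)%N}.
Proof. exact: adm_gt0 adm. Qed.

(** If [k < k0], then [b] divides [c - k] or [c + k] by [dvdn_near]. The former lies strictly
    between 0 and [b], the latter is below [2 b]. *)
Lemma near_multiple (c b k0 : nat) : c \in s -> b \in s -> (c < b)%N -> (k0 <= c)%N ->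
  (b %| Q - 1)%N || (b %| Q + 1)%N ->
  (k0 * Q <= b * dist Q c b + c)%N \/
  exists k, [/\ (0 < k < k0)%N, b = (c + k)%N & (k * Q <= b * dist Q c b + c)%N].
Proof.
move=> cs bs cb k0c bQ; have Q4 := adm_Q adm; have c3 := adm_lt adm cs.
have cQ : (c < Q)%N by lia.
have [_ [k kE]] := distP (ltn_trans (isT : 1 < 3)%N Q4) (adm_coprime adm bs) cQ.
have kd : (k * Q <= b * dist Q c b + c)%N by case: kE; lia.
have [k0k|kk0] := leqP k0 k.
  by left; apply: leq_trans kd; rewrite leq_mul2r k0k orbT.
right; exists k; have c0 := adm_gt0 adm cs.
have ck := dvdn_near (leq_trans kk0 k0c) cQ bQ kE.
case/orP: ck => [|/(dvdn_leq _)]; last by rewrite subn_gt0 => /(_ ltac:(lia)); lia.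
by move=> /dvdnP[[|[|x]] E]; [lia| |nia]; split=> //; lia.
Qed.

Definition divisor_sum (c : nat) : R := \sum_(b <- s | (b != c) && (b %| c)%N) Kd R Q c b.

(** The divisors of [c] in the set other than [c] are distinct powers of 2 up to [D]: they add up to
    at most [2 D - 1], and their inverses to at most 2, which doubles [203 / 100]. *)
Lemma divisor_sum_le (c D : nat) : c \in s -> {in s, forall b, ~~ pow2 b -> (c <= b)%N} ->
  (0 < D)%N -> (forall b, pow2 b -> (b %| c)%N = (b %| D)%N) ->
  divisor_sum c <= (2 * D%:R - 1) / c%:R + 406 / 100 * c%:R / q ^+ 2.
Proof.
move=> cs cmin D0 Dc; have c0 : 0 < c%:R :> R by rewrite ltr0n (adm_gt0 adm).
have q0 : 0 < q by rewrite ltr0n; have := adm_Q adm; lia.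
have dp : {in s, forall b, (b != c) && (b %| c)%N -> pow2 b && (b <= D)%N}.
  move=> b bs /andP[bc bdc]; have pb : pow2 b.
    apply: contraT => /(cmin _ bs) cb.
    by move: bc; rewrite eqn_leq cb (dvdn_leq (adm_gt0 adm cs) bdc).
  by rewrite pb dvdn_leq// -Dc.
apply: (@le_trans _ _ (\sum_(b <- s | (b != c) && (b %| c)%N)
    (b%:R / c%:R + 203 / 100 * (c%:R / q ^+ 2) * b%:R^-1))).
  rewrite /divisor_sum big_seq_cond [leRHS]big_seq_cond; apply: ler_sum => b /and3P[bs _ bc].
  apply: le_trans (Kd_dvd R adm cs bs bc) _.
  by rewrite lerD2l -!mulrA ler_wpM2l// !mulrA [_ / b%:R / _]mulrAC.
rewrite big_split/= -mulr_suml -mulr_sumr; apply: lerD.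
  rewrite ler_pM2r ?invr_gt0// -natr_sum -natrM lerBrDr natr1 ler_nat.
  apply: sum_pow2_lt => //; exact: adm_uniq adm.
have -> : 406 / 100 * c%:R / q ^+ 2 = 203 / 100 * (c%:R / q ^+ 2) * 2 :> R by field; rewrite gt_eqF.
apply: ler_wpM2l; first by rewrite mulr_ge0// divr_ge0// exprn_ge0.
apply: sum_pow2_inv_le; first exact: adm_uniq adm.
by move=> b bs /(dp _ bs)/andP[].
Qed.

End NearMultiples.

(** * Slack functions for the two-row estimates *)

Section Slack.
Variable R : realType.
Implicit Type b : nat.

Lemma excess_nat_anti b (n : nat) (u : R) : (2 <= n)%N -> (n <= b)%N -> excess (n%:R : R) <= u ->
  excess (b%:R : R) <= u.
Proof. by move=> n2 nb; apply: le_trans; apply: excess_anti; rewrite ler_nat. Qed.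

Definition slack (n : nat) (u v : R) b : R := if (b < n)%N then u - v * b%:R else 0.

(** Fitted to [slack_ge10_far]: [425 / 100 - 9 / 100 b] just covers what [207 / 100 b + 423 / 100]
    has above [216 / 100 b], and it is positive up to 47. *)
Definition slack_ge10 := slack 48 (425 / 100) (9 / 100).
Definition slack_lt10 := slack 33 (45 / 10) (14 / 100).

Lemma slackP (n : nat) (u v : R) b :
  (b%:R + 1 <= n%:R :> R /\ slack n u v b = u - v * b%:R) \/
  (n%:R <= b%:R :> R /\ slack n u v b = 0).
Proof.
by rewrite /slack; case: ltnP => nb; [left|right]; rewrite ?natr1 ler_nat.
Qed.

Lemma excess_ge2 b : (2 <= b)%N -> excess (b%:R : R) <= 141 / 100.
Proof. by move=> b2; apply: (excess_nat_anti (n := 2)) => //; rewrite /excess ler_pdivrMr; lra. Qed.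

(** The suffixes name the kinds of [b]: [dvd] divides [c]; [far] divides neither [Q - 1] nor
    [Q + 1]; [pow] is below [c], hence a power of 2; [near] exceeds [c], divides [Q - 1] or [Q + 1],
    and has a large [k] in row [c]. *)
Lemma slack_ge10_dvd b : (2 <= b)%N -> 2 * (b%:R + excess b%:R) <= 216 / 100 * b%:R + slack_ge10 b.
Proof.
move=> b2; have := excess_ge2 b2; have b2R : 2 <= b%:R :> R by rewrite ler_nat.
by rewrite /slack_ge10; case: (slackP 48 (425 / 100) (9 / 100) b) => -[bn ->]; lra.
Qed.

Lemma slack_ge10_far b : 207 / 100 * b%:R + 423 / 100 <= 216 / 100 * b%:R + slack_ge10 b.
Proof. by rewrite /slack_ge10; case: (slackP 48 (425 / 100) (9 / 100) b) => -[bn ->]; lra. Qed.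

Lemma slack_ge10_pow b : (2 <= b)%N ->
  2 * (b%:R + excess b%:R) + (107 / 100 * b%:R + 141 / 100) <= 216 / 100 * b%:R + slack_ge10 b + b%:R.
Proof.
move=> b2; have := excess_ge2 b2.
by rewrite /slack_ge10; case: (slackP 48 (425 / 100) (9 / 100) b) => -[bn ->]; lra.
Qed.

Lemma slack_ge10_near b : (11 <= b)%N ->
  2 * (b%:R + excess b%:R) + (11 / 100 * b%:R + 141 / 100) <= 216 / 100 * b%:R + slack_ge10 b.
Proof.
move=> b11; have xb : excess (b%:R : R) <= 16 / 100.
  by apply: (excess_nat_anti (n := 11)) => //; rewrite /excess ler_pdivrMr; lra.
by rewrite /slack_ge10; case: (slackP 48 (425 / 100) (9 / 100) b) => -[bn ->]; lra.
Qed.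

Lemma slack_lt10_dvd b : (2 <= b)%N -> 2 * (b%:R + excess b%:R) <= 24 / 10 * b%:R + slack_lt10 b.
Proof.
move=> b2; have := excess_ge2 b2; have b2R : 2 <= b%:R :> R by rewrite ler_nat.
by rewrite /slack_lt10; case: (slackP 33 (45 / 10) (14 / 100) b) => -[bn ->]; lra.
Qed.

Lemma slack_lt10_far b : (2 <= b)%N -> 201 / 100 * b%:R + 423 / 100 <= 24 / 10 * b%:R + slack_lt10 b.
Proof.
move=> b2; have b2R : 2 <= b%:R :> R by rewrite ler_nat.
by rewrite /slack_lt10; case: (slackP 33 (45 / 10) (14 / 100) b) => -[bn ->]; lra.
Qed.

Lemma slack_lt10_pow b : (2 <= b)%N ->
  2 * (b%:R + excess b%:R) + (101 / 100 * b%:R + 141 / 100) <=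
  24 / 10 * b%:R + slack_lt10 b + 8 / 10 * b%:R.
Proof.
move=> b2; have := excess_ge2 b2; have b2R : 2 <= b%:R :> R by rewrite ler_nat.
by rewrite /slack_lt10; case: (slackP 33 (45 / 10) (14 / 100) b) => -[bn ->]; lra.
Qed.

Lemma slack_lt10_near b : (4 <= b)%N ->
  2 * (b%:R + excess b%:R) + (34 / 100 * b%:R + 141 / 100) <= 24 / 10 * b%:R + slack_lt10 b.
Proof.
move=> b4; have x4 : excess (b%:R : R) <= 46 / 100.
  by apply: (excess_nat_anti (n := 4)) => //; rewrite /excess ler_pdivrMr; lra.
have [b16|b16] := ltnP b 16.
  have b16R : b%:R + 1 <= 16%:R :> R by rewrite natr1 ler_nat.
  by rewrite /slack_lt10; case: (slackP 33 (45 / 10) (14 / 100) b) => -[bn ->]; lra.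
have x16 : excess (b%:R : R) <= 11 / 100.
  by apply: (excess_nat_anti (n := 16)) => //; rewrite /excess ler_pdivrMr; lra.
by rewrite /slack_lt10; case: (slackP 33 (45 / 10) (14 / 100) b) => -[bn ->]; lra.
Qed.

Lemma slack_ge0 (n : nat) (u v : R) b : 0 <= v -> v * (n%:R - 1) <= u -> 0 <= slack n u v b.
Proof.
move=> v0 uv; case: (slackP n u v b) => -[bn ->] //.
by rewrite subr_ge0; apply: le_trans uv; rewrite ler_wpM2l//; lra.
Qed.

Lemma sum_slack (n : nat) (u v : R) : (2 <= n)%N ->
  \sum_(2 <= b < n) slack n u v b = u * (n%:R - 2) - v * (n%:R * (n%:R - 1) / 2 - 1).
Proof.
move=> n2; rewrite (eq_big_nat _ _ (F2 := fun b => - v * b%:R + u)); last first.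
  by move=> b /andP[_ bn]; rewrite /slack bn mulNr addrC.
have := sum_affine (- v) u n.
by rewrite (@big_cat_nat _ _ _ 2)//= big_ltn// big_ltn// big_geq//; lra.
Qed.

End Slack.

Section TwoRows.
Variables (R : realType) (Q : nat) (s : seq nat).
Hypotheses (adm : admissible Q s) (s1 : 1%N \in s).
Local Notation q := (Q%:R : R).
Local Notation p := (q - 1%:R : R).

Lemma row_le_wraps (c b k : nat) (u : R) : c \in s -> b \in s -> (0 < k)%N ->
  (k * Q <= b * dist Q c b + c)%N -> p <= u * (k%:R * q - c%:R) ->
  p * Kd R Q c b <= u * b%:R + 141 / 100.
Proof.
move=> cs bs k0 kd pu; have c3 := adm_lt adm cs.
have q0 : 0 < q by rewrite ltr0n (leq_ltn_trans _ c3).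
have cq : c%:R < q by rewrite ltr_nat (leq_ltn_trans _ c3)// leq_pmull.
have qk : q <= k%:R * q by rewrite ler_peMl ?ler1n// ltW.
have t0 : 0 < k%:R * q - c%:R by lra.
have p0 : 0 < p := Q_sub_gt0 R adm s1.
have := Kd_le_lin adm cs bs t0.
rewrite lerBlDr -!natrM -natrD ler_nat => /(_ kd).
rewrite natrM => /(ler_wpM2l (ltW p0)) h; apply: le_trans h _.
have -> : p * (b%:R / (k%:R * q - c%:R) + 141 / 100 / q) =
    b%:R * p / (k%:R * q - c%:R) + 141 / 100 * p / q by field; rewrite !gt_eqF.
apply: lerD; rewrite ler_pdivrMr//; last by lra.
by rewrite -[leRHS]mulrA [leRHS]mulrCA ler_wpM2l.
Qed.

(* [Y] is a slack bounded over a window, [E] an extra cost of exceptional elements. *)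
Lemma two_rows_le (c : nat) (lam : R) (Y E : nat -> R) : c \in s -> c != 1%N ->
  {in s, forall b, b != 1%N -> b != c ->
    p * (2 * Kd R Q 1 b + (if (b %| c)%N then 0 else Kd R Q c b)) <= lam * b%:R + Y b + E b} ->
  0 <= lam ->
  p * (2 * rowsum R Q s 1 + rowsum R Q s c) <=
    2 * (c%:R + excess c%:R) + lam * (p - c%:R) +
    \sum_(b <- s | (b != 1%N) && (b != c)) Y b + \sum_(b <- s | (b != 1%N) && (b != c)) E b +
    p * divisor_sum R Q s c.
Proof.
move=> cs c1 W lam0; have us := adm_uniq adm.
have -> : divisor_sum R Q s c = Kd R Q c 1 +
    \sum_(b <- s | (b != 1%N) && (b != c)) (if (b %| c)%N then Kd R Q c b else 0).
  rewrite /divisor_sum (bigD1_seq_cond (P := fun b => (b != c) && (b %| c)%N) _ us s1)/=; last first.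
    by rewrite eq_sym c1 dvd1n.
  rewrite -big_mkcondr; congr (_ + _); apply: eq_bigl => b.
  by rewrite andbC andbA.
rewrite (weighted_split R adm s1 cs c1).
have sb := sum_rest R adm s1 cs c1.
have Kc := min_row_le R adm s1 (one_min adm) cs c1.
have -> : \sum_(b <- s | (b != 1%N) && (b != c)) (2 * Kd R Q 1 b + Kd R Q c b) =
   \sum_(b <- s | (b != 1%N) && (b != c)) (2 * Kd R Q 1 b + (if (b %| c)%N then 0 else Kd R Q c b)) +
   \sum_(b <- s | (b != 1%N) && (b != c)) (if (b %| c)%N then Kd R Q c b else 0).
  by rewrite -big_split/=; apply: eq_bigr => b _; case: ifP => _; rewrite ?addr0 ?add0r.
have tot : p * \sum_(b <- s | (b != 1%N) && (b != c))
     (2 * Kd R Q 1 b + (if (b %| c)%N then 0 else Kd R Q c b)) <=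
   lam * (p - c%:R) + \sum_(b <- s | (b != 1%N) && (b != c)) Y b +
   \sum_(b <- s | (b != 1%N) && (b != c)) E b.
  apply: (@le_trans _ _ (\sum_(b <- s | (b != 1%N) && (b != c)) (lam * b%:R + Y b + E b))).
    rewrite mulr_sumr big_seq_cond [leRHS]big_seq_cond; apply: ler_sum => b /and3P[bs b1 bc].
    exact: W.
  rewrite !big_split/= -mulr_sumr !lerD2r.
  by rewrite ler_wpM2l.
move: tot; move: (\sum_(_ <- _ | _) (2 * _ + _)) (\sum_(_ <- _ | _) (if _ then _ else _)) => S T.
by lra.
Qed.

End TwoRows.

Lemma sqr_lt_lin1000 (R : realType) (x q : R) : 10 * 100 <= q -> x ^+ 2 < 4 * q ->
  x <= 8 / 125 * q.
Proof.
move=> Q_ge1000 xq; have : 0 <= (x - 125 / 2) ^+ 2 by rewrite sqr_ge0.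
by lra.
Qed.

Definition pow_extra (R : realType) (v : R) (c b : nat) : R :=
  if (b < c)%N && ~~ (b %| c)%N then v * b%:R else 0.

(** Surcharge of the exceptional elements [b = c + k] of [near_multiple]: entry [k - 1] of [r], in
    hundredths of the weight of [b]. *)
Definition near_extra (R : realType) (r : seq nat) (c b : nat) : R :=
  if b \in [seq (c + k)%N | k <- iota 1 (size r)] then (nth 0%N r (b - c - 1))%:R / 100 * b%:R else 0.

Lemma pow_extra_ge0 (R : realType) (v : R) c b : 0 <= v -> 0 <= pow_extra v c b.
Proof. by move=> v0; rewrite /pow_extra; case: ifP => // _; rewrite mulr_ge0. Qed.

Lemma near_extra_ge0 (R : realType) r c b : 0 <= near_extra R r c b.
Proof. by rewrite /near_extra; case: ifP => // _; rewrite mulr_ge0// divr_ge0. Qed.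

Lemma near_extraE (R : realType) r c k : (0 < k <= size r)%N ->
  near_extra R r c (c + k) = (nth 0%N r k.-1)%:R / 100 * (c + k)%:R.
Proof.
move=> /andP[k0 kr]; rewrite /near_extra ifT; first by rewrite addKn subn1.
by apply/mapP; exists k; rewrite // mem_iota k0 add1n ltnS.
Qed.

Lemma sum_near_extra (R : realType) (s : seq nat) (P : pred nat) r c : uniq s ->
  \sum_(b <- s | P b) near_extra R r c b <=
  \sum_(0 <= k < size r) (nth 0%N r k)%:R / 100 * (c%:R + k.+1%:R).
Proof.
move=> us; rewrite -big_mkcondr/=.
apply: le_trans (@ler_sum_sub _ s [seq (c + k)%N | k <- iota 1 (size r)] _ _ us _ _) _.
- by move=> b _ /andP[].
- by move=> b _; rewrite mulr_ge0// divr_ge0.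
rewrite big_map /index_iota subn0 -[1%N]addn0 iotaDl big_map le_eqVlt; apply/orP; left; apply/eqP.
by apply: eq_bigr => k _; rewrite addKn add1n subn1/= natrD.
Qed.

(** * Least element 1: first non-power of 2 at least 10, with [c^2 < 4 Q] *)

Section FirstNonPow2.
Variables (R : realType) (Q : nat) (s : seq nat) (c : nat).
Hypotheses (adm : admissible Q s) (s1 : 1%N \in s) (Q1000 : (1000 <= Q)%N).
Hypotheses (cs : c \in s) (cpow : ~~ pow2 c) (cmin : {in s, forall b, ~~ pow2 b -> (c <= b)%N}).
Local Notation q := (Q%:R : R).
Local Notation p := (q - 1%:R : R).

Lemma Q_ge1000 : 10 * 100 <= q.
Proof. by rewrite -natrM ler_nat. Qed.

(* Entry [k - 1] over 100, plus 11 / 100, is an upper bound of [1 / (k - 8 / 125)]. *)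
Definition near_coefs_ge10 := [:: 96; 41; 24; 15; 10; 6; 4; 2; 1]%N.

(** The threshold 10 is the [k0] of [near_multiple], which needs [k0 <= c]; smaller [c] are treated
    separately with [k0 = 3]. The bounds [107 / 100] and [11 / 100] are for [p / (Q - c)] and
    [p / (10 Q - c)]. *)
Lemma two_rows_term_ge10 : (10 <= c)%N -> c%:R <= 8 / 125 * q ->
  {in s, forall b, b != 1%N -> b != c ->
    p * (2 * Kd R Q 1 b + (if (b %| c)%N then 0 else Kd R Q c b)) <=
    216 / 100 * b%:R + slack_ge10 R b + (pow_extra 1 c b + near_extra R near_coefs_ge10 c b)}.
Proof.
move=> c10 cq b bs b1 bc; have q1 := Q_ge1000.
have b2 : (2 <= b)%N by have := adm_gt0 adm bs; case: (b) b1 => [|[]].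
have e1 := @pow_extra_ge0 R 1 c b ler01; have e2 := near_extra_ge0 R near_coefs_ge10 c b.
have amin := one_min adm.
have [bdc|bdc] := boolP (b %| c)%N.
  by have := min_row_le R adm s1 amin bs b1; have := slack_ge10_dvd R b2; lra.
have Kc := @row_le_ndvd R Q s 1 adm s1 c b (107 / 100) cs bs bdc ltac:(lra).
have [nb|] := boolP ((b %| Q - 1)%N || (b %| Q + 1)%N); last first.
  rewrite negb_or => /andP[bm bp].
  by have := min_row_le_far R adm s1 amin bs b1 bm bp; have := slack_ge10_far R b; lra.
have Ka := min_row_le R adm s1 amin bs b1.
have [cb|bltc] := ltnP c b; last first.
  have : (b < c)%N by rewrite ltn_neqAle bc.
  move=> {}bltc; rewrite /pow_extra bltc bdc mul1r.
  by have := slack_ge10_pow R b2; lra.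
have [k10|[k [/andP[k0 k10] bck kd]]] := near_multiple adm cs bs cb c10 nb.
  have Kc' := @row_le_wraps R Q s adm s1 c b 10 (11 / 100) cs bs isT k10 ltac:(lra).
  by have := slack_ge10_near R (leq_ltn_trans c10 cb); lra.
have near := slack_ge10_near R (leq_ltn_trans c10 cb).
suff pk : p <= (11 / 100 + (nth 0%N near_coefs_ge10 k.-1)%:R / 100) * (k%:R * q - c%:R).
  have Kc' := row_le_wraps adm s1 cs bs k0 kd pk.
  have := near_extraE R (r := near_coefs_ge10) c (k := k); rewrite k0/= -ltnS k10 => /(_ isT).
  by rewrite -bck => E; rewrite E; lra.
clear bck kd; case: k k0 k10 => [|[|[|[|[|[|[|[|[|[|k]]]]]]]]]]// _ _ /=; lra.
Qed.

Lemma sum_pow_extra (v : R) : 0 <= v ->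
  \sum_(b <- s | (b != 1%N) && (b != c)) pow_extra v c b <= v * (2 * c%:R).
Proof.
move=> v0; rewrite -big_mkcondr/= -mulr_sumr ler_wpM2l// -natr_sum -natrM ler_nat ltnW//.
apply: sum_pow2_lt => [||b bs]; [exact: adm_uniq adm|exact: adm_gt0 adm _ cs|].
case/and3P => _ bc _; rewrite (ltnW bc) andbT.
by apply: contraT => /(cmin bs); rewrite leqNgt bc.
Qed.

(** For [m = 3] the only power of 2 below [c] not dividing it is [2 D]. This improves [2 c = 6 D] in
    the case where the divisors of [c] cost most. *)
Lemma sum_pow_extra3 (v : R) (D : nat) : 0 <= v -> c = (D * 3)%N -> pow2 D ->
  (forall b, pow2 b -> (b %| c)%N = (b %| D)%N) ->
  \sum_(b <- s | (b != 1%N) && (b != c)) pow_extra v c b <= v * (2 * D%:R).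
Proof.
move=> v0 cD Dp Dc; rewrite -big_mkcondr/= -mulr_sumr ler_wpM2l// -natrM.
apply: le_trans (@ler_sum_sub _ s [:: (2 * D)%N] _ _ (adm_uniq adm) _ _) _; last by rewrite big_seq1.
  move=> b bs /and3P[_ bc bdc]; rewrite mem_seq1; apply/eqP.
  have bp : pow2 b by apply: contraT => /(cmin bs); rewrite leqNgt bc.
  by apply: pow2_between => //; rewrite -?Dc// -cD.
by [].
Qed.

Lemma sum_slack_full (n : nat) (u v : R) : (2 <= n)%N -> 0 <= v -> v * (n%:R - 1) <= u ->
  \sum_(b <- s | (b != 1%N) && (b != c)) slack n u v b <=
  u * (n%:R - 2) - v * (n%:R * (n%:R - 1) / 2 - 1).
Proof.
move=> n2 v0 uv; rewrite -sum_slack//.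
have -> : \sum_(b <- s | (b != 1%N) && (b != c)) slack n u v b =
    \sum_(b <- s | (b != 1%N) && (b != c)) (if (b < n)%N then slack n u v b else 0).
  by apply: eq_bigr => b _; rewrite /slack; case: ifP.
apply: ler_sum_window; first exact: adm_uniq adm.
  move=> b bs /andP[b1 _]; rewrite ltn_neqAle eq_sym b1; exact: adm_gt0 adm _ bs.
by move=> b _; apply: slack_ge0.
Qed.

(** The slack vanishes from 48 on, and the elements below 48 are now powers of 2. *)
Lemma sum_slack_ge10_pow : (48 <= c)%N ->
  \sum_(b <- s | (b != 1%N) && (b != c)) slack_ge10 R b <= 16.
Proof.
move=> c48; rewrite /slack_ge10 /slack -big_mkcondr/=.
apply: le_trans (@ler_sum_sub _ s [:: 2; 4; 8; 16; 32]%N _ _ (adm_uniq adm) _ _) _.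
- move=> b bs /andP[/andP[b1 _] b48].
  have : pow2 b by apply: contraT => /(cmin bs); rewrite leqNgt (leq_trans b48 c48).
  case/pow2P => i bE; move: b1 b48; rewrite {}bE.
  have [i6|i6] := ltnP i 6; last first.
    by move=> _; rewrite ltnNge (leq_trans (_ : 48 <= 2 ^ 6)%N)// leq_exp2l.
  by case: i i6 => [|[|[|[|[|[|i]]]]]].
- by apply/allP; rewrite /= !andbT; do !(apply/andP; split); lra.
by rewrite !big_cons big_nil; lra.
Qed.

Lemma row_divisors_le (D m : nat) : c = (D * m)%N -> (0 < m)%N ->
  (forall b, pow2 b -> (b %| c)%N = (b %| D)%N) -> c%:R <= 8 / 125 * q ->
  p * divisor_sum R Q s c <= p * ((2 * D%:R - 1) / c%:R) + 26 / 100.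
Proof.
move=> cE m0 Dc cq; have c0 := adm_gt0 adm cs; have q1 := Q_ge1000.
have D0 : (0 < D)%N by move: c0; rewrite cE; case: (D).
have p0 : 0 < p := Q_sub_gt0 R adm s1.
have q0 : 0 < q by lra.
apply: le_trans (ler_wpM2l (ltW p0) (divisor_sum_le R adm cs cmin D0 Dc)) _.
rewrite mulrDr lerD2l mulrA ler_pdivrMr ?exprn_gt0//.
have : 0 <= q * (8 / 125 * q - c%:R) by rewrite mulr_ge0//; lra.
have : 0 <= c%:R :> R by [].
have : 0 <= q ^+ 2 by rewrite sqr_ge0.
by lra.
Qed.

Lemma two_rowsums_ge10_lt : (10 <= c)%N -> (c ^ 2 < 4 * Q)%N ->
  2 * rowsum R Q s 1 + rowsum R Q s c < 3.
Proof.
move=> c10 cQ; have q1 := Q_ge1000.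
have cR : c%:R ^+ 2 < 4 * q by rewrite -natrX -natrM ltr_nat.
have cq := sqr_lt_lin1000 q1 cR.
have c10R : 10 <= c%:R :> R by rewrite ler_nat.
have c1 : c != 1%N by apply: contraTneq c10 => ->.
have p0 : 0 < p := Q_sub_gt0 R adm s1.
have main := two_rows_le adm s1 cs c1 (two_rows_term_ge10 c10 cq) ltac:(lra).
have xc : excess (c%:R : R) <= 68 / 100 by apply: excess_ge3; lra.
rewrite big_split/= in main.
have nx := sum_near_extra R (fun b => (b != 1%N) && (b != c)) near_coefs_ge10 c (adm_uniq adm).
have {}nx : \sum_(b <- s | (b != 1%N) && (b != c)) near_extra R near_coefs_ge10 c b <=
    199 / 100 * c%:R + 449 / 100.
  by apply: le_trans nx _; do 9 rewrite big_ltn//; rewrite big_geq//=; lra.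
have [D [m [cE Dp mo m3 Dc]]] := pow2_part (adm_gt0 adm cs) cpow.
have D0 : (0 < D)%N by case: (D) cE c10 => // ->.
have pP : p * divisor_sum R Q s c <= 2 / m%:R * p + 1.
  have := row_divisors_le cE (ltnW (ltnW m3)) Dc cq.
  suff : (2 * D%:R - 1) / c%:R <= 2 / m%:R :> R by rewrite -(ler_pM2l p0); lra.
  have m0 : (0 < m)%N by rewrite (leq_trans _ m3).
  rewrite cE natrM ler_pdivrMr ?mulr_gt0 ?ltr0n//.
  have -> : 2 / m%:R * (D%:R * m%:R) = 2 * D%:R :> R by field; rewrite pnatr_eq0 -lt0n.
  by lra.
have mc0 : 0 < m%:R :> R by rewrite ltr0n (leq_trans _ m3).
have m3R : 3 <= m%:R :> R by rewrite ler_nat.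
rewrite -(ltr_pM2l p0).
have [m5|m5] := leqP 5 m.
  have m5R : 5 <= m%:R :> R by rewrite ler_nat.
  have mi : 2 / m%:R * p <= 4 / 10 * p.
    by rewrite ler_pM2r// ler_pdivrMr//; lra.
  have pe := @sum_pow_extra 1 ler01.
  have sl : \sum_(b <- s | (b != 1%N) && (b != c)) slack_ge10 R b <= 941 / 10.
    by apply: le_trans (sum_slack_full _ _ _) _ => //; lra.
  have : 0 <= (c%:R - 63) ^+ 2 :> R by rewrite sqr_ge0.
  by lra.
have mE : m = 3 by case: (m) mo m3 m5 => [|[|[|[|[|]]]]].
have cD : c = (D * 3)%N by rewrite cE mE.
have cDR : c%:R = D%:R * 3 :> R by rewrite cD natrM.
have pe := sum_pow_extra3 ler01 cD Dp Dc.
have mi : 2 / m%:R * p = 2 / 3 * p by rewrite mE.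
have sl : \sum_(b <- s | (b != 1%N) && (b != c)) slack_ge10 R b <= 941 / 10.
  by apply: le_trans (sum_slack_full _ _ _) _ => //; lra.
have [i DE] : exists i, D = (2 ^ i)%N by apply/pow2P.
(* For [m = 3] only about [0.17 p] is left. If [D <= 8], [c] is small enough for the full slack;
   from [D = 16] on the slack is at most 16; and [D >= 32] gives [c >= 96], so that [c^2 < 4 Q]
   bounds [c] by [Q / 24]. *)
have [i3|i3] := leqP i 3.
  have D8 : D%:R <= 8%:R :> R by rewrite ler_nat DE (leq_pexp2l (n2 := 3)).
  by lra.
have y16 : \sum_(b <- s | (b != 1%N) && (b != c)) slack_ge10 R b <= 16.
  by apply: sum_slack_ge10_pow; rewrite cD (leq_mul2r 3 16) DE (leq_pexp2l (m := 2) _ i3).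
have [i4|i4] := leqP i 4.
  have D16 : D%:R <= 16%:R :> R by rewrite ler_nat DE (leq_pexp2l (n2 := 4)).
  by lra.
have D32 : 32%:R <= D%:R :> R by rewrite ler_nat DE (leq_pexp2l (m := 2) _ i4).
have : 0 <= c%:R * (c%:R - 96) :> R by rewrite mulr_ge0//; lra.
by lra.
Qed.

End FirstNonPow2.

(** * Least element 1: first non-power of 2 below 10 *)

Section SmallFirstNonPow2.
Variables (R : realType) (Q : nat) (s : seq nat) (c : nat).
Hypotheses (adm : admissible Q s) (s1 : 1%N \in s) (Q1000 : (1000 <= Q)%N).
Hypotheses (cs : c \in s) (cpow : ~~ pow2 c) (cmin : {in s, forall b, ~~ pow2 b -> (c <= b)%N}).
Local Notation q := (Q%:R : R).
Local Notation p := (q - 1%:R : R).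

Lemma nonpow2_ge3 : (3 <= c)%N.
Proof. by have := adm_gt0 adm cs; case: (c) cpow => [|[|[|]]]. Qed.

(* As [near_coefs_ge10], with base 34 / 100 and [c <= 9]. *)
Definition near_coefs_lt10 := [:: 67; 17]%N.

Lemma two_rows_term_lt10 : (c < 10)%N ->
  {in s, forall b, b != 1%N -> b != c ->
    p * (2 * Kd R Q 1 b + (if (b %| c)%N then 0 else Kd R Q c b)) <=
    24 / 10 * b%:R + slack_lt10 R b + (pow_extra (8 / 10) c b + near_extra R near_coefs_lt10 c b)}.
Proof.
move=> c10 b bs b1 bc; have q1 := Q_ge1000 R Q1000.
have c9 : c%:R <= 9 :> R by rewrite ler_nat.
have b2 : (2 <= b)%N by have := adm_gt0 adm bs; case: (b) b1 => [|[]].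
have v0 : 0 <= 8 / 10 :> R by lra.
have e1 := pow_extra_ge0 c b v0; have e2 := near_extra_ge0 R near_coefs_lt10 c b.
have amin := one_min adm.
have [bdc|bdc] := boolP (b %| c)%N.
  by have := min_row_le R adm s1 amin bs b1; have := slack_lt10_dvd R b2; lra.
have Kc := @row_le_ndvd R Q s 1 adm s1 c b (101 / 100) cs bs bdc ltac:(lra).
have [nb|] := boolP ((b %| Q - 1)%N || (b %| Q + 1)%N); last first.
  rewrite negb_or => /andP[bm bp].
  by have := min_row_le_far R adm s1 amin bs b1 bm bp; have := slack_lt10_far R b2; lra.
have Ka := min_row_le R adm s1 amin bs b1.
have [cb|bltc] := ltnP c b; last first.
  have : (b < c)%N by rewrite ltn_neqAle bc.
  move=> {}bltc; rewrite /pow_extra bltc bdc/=.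
  by have := slack_lt10_pow R b2; lra.
have near := slack_lt10_near R (leq_ltn_trans nonpow2_ge3 cb).
have [k10|[k [/andP[k0 k10] bck kd]]] := near_multiple adm cs bs cb nonpow2_ge3 nb.
  have Kc' := @row_le_wraps R Q s adm s1 c b 3 (34 / 100) cs bs isT k10 ltac:(lra).
  by lra.
suff pk : p <= (34 / 100 + (nth 0%N near_coefs_lt10 k.-1)%:R / 100) * (k%:R * q - c%:R).
  have Kc' := row_le_wraps adm s1 cs bs k0 kd pk.
  have := near_extraE R (r := near_coefs_lt10) c (k := k); rewrite k0/= -ltnS k10 => /(_ isT).
  by rewrite -bck => E; rewrite E; lra.
clear bck kd; case: k k0 k10 => [|[|[|k]]]// _ _ /=; lra.
Qed.

(** Below 10 only [D = 1] and [D = 2] are possible, with equality at [c = 6]. The divisors thus take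
    at most [p / 2], which with [24 / 10 p] leaves [p / 10] for the slack. *)
Lemma divisor_half (D m : nat) : (c < 10)%N -> c = (D * m)%N -> pow2 D -> (3 <= m)%N ->
  (2 * (2 * D) <= c + 2)%N.
Proof.
move=> c10 cE /pow2P[[|[|i]] DE] m3; subst D; rewrite ?expn1 in cE *; [lia|lia|].
by rewrite !expnS in cE *; have := expn_gt0 2 i; nia.
Qed.

Lemma two_rowsums_lt10_lt : (c < 10)%N -> 2 * rowsum R Q s 1 + rowsum R Q s c < 3.
Proof.
move=> c10; have q1 := Q_ge1000 R Q1000; have c3 := nonpow2_ge3.
have three_mul_lt : 3 <= c%:R :> R by rewrite ler_nat.
have c9 : c%:R <= 9 :> R by rewrite ler_nat.
have c1 : c != 1%N by apply: contraTneq c3 => ->.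
have p0 : 0 < p := Q_sub_gt0 R adm s1.
have main := two_rows_le adm s1 cs c1 (two_rows_term_lt10 c10) ltac:(lra).
have xc : excess (c%:R : R) <= 68 / 100 by apply: excess_ge3.
rewrite big_split/= in main.
have nx := sum_near_extra R (fun b => (b != 1%N) && (b != c)) near_coefs_lt10 c (adm_uniq adm).
have {}nx : \sum_(b <- s | (b != 1%N) && (b != c)) near_extra R near_coefs_lt10 c b <=
    84 / 100 * c%:R + 101 / 100.
  by apply: le_trans nx _; do 2 rewrite big_ltn//; rewrite big_geq//=; lra.
have [D [m [cE Dp mo m3 Dc]]] := pow2_part (adm_gt0 adm cs) cpow.
have v0 : 0 <= 8 / 10 :> R by lra.
have pe := sum_pow_extra adm cs cmin v0.
have sl : \sum_(b <- s | (b != 1%N) && (b != c)) slack_lt10 R b <= 658 / 10.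
  by apply: le_trans (sum_slack_full c adm _ _ _) _ => //; lra.
have pP := row_divisors_le adm s1 Q1000 cs cmin cE (leq_trans (isT : 0 < 3)%N m3) Dc ltac:(lra).
have h : (2 * D%:R - 1) / c%:R <= 1 / 2 :> R.
  rewrite ler_pdivrMr ?ltr0n//; last by rewrite (leq_trans _ c3).
  by have := divisor_half c10 cE Dp m3; rewrite -(ler_nat R) natrD !natrM; lra.
move: h; rewrite -(ler_pM2l p0) -(ltr_pM2l p0) => h.
by lra.
Qed.

End SmallFirstNonPow2.

Lemma not_small_ge19 (Q b : nat) : (1000 <= Q)%N -> ~~ small Q b -> (19 <= b)%N.
Proof. by rewrite /small negb_or -ltnNge -leqNgt -mulnn => ? /andP[? ?]; nia. Qed.

(** For [c = 3 D] this makes [row_not_small] available for the exceptional power [2 D]. *)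
Lemma not_small_two_thirds (Q D : nat) : (1000 <= Q)%N -> (4 * Q <= (D * 3) ^ 2)%N ->
  ~~ small Q (2 * D).
Proof.
rewrite /small negb_or -ltnNge -leqNgt -!mulnn => Q1000 DQ.
have D22 : (21 < D)%N by nia.
by apply/andP; split; [lia|nia].
Qed.

(** * Least element 1: first non-power of 2 with [c^2 >= 4 Q] *)

Section LargeFirstNonPow2.
Variables (R : realType) (Q : nat) (s : seq nat) (c : nat).
Hypotheses (adm : admissible Q s) (s1 : 1%N \in s) (Q1000 : (1000 <= Q)%N).
Hypothesis f1 : 1 <= rowsum R Q s 1.
Hypotheses (cs : c \in s) (cpow : ~~ pow2 c) (cmin : {in s, forall b, ~~ pow2 b -> (c <= b)%N}).
Hypothesis cQ : (4 * Q <= c ^ 2)%N.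
Local Notation q := (Q%:R : R).
(** From [dual_dist]: a non-small [b] costs about [g Q / (Q - e)] with [g <= (Q + 1) / c] and
    [e <= (Q + 1) / 19]. This does not depend on [b]. *)
Let kappa : R := 107 / 100 * q / c%:R + 141 / 100.

Lemma nonpow2_ge64 : (64 <= c)%N && ~~ small Q c.
Proof.
have /andP[_ ->] := not_small_ge34 (leq_trans (isT : 300 <= 1000)%N Q1000) cQ.
by rewrite andbT; move: cQ Q1000; rewrite -mulnn; clear; nia.
Qed.

Lemma nonpow2_ge64_real : 64 <= c%:R :> R.
Proof. by have /andP[c64 _] := nonpow2_ge64; rewrite ler_nat. Qed.

Lemma three_mul_lt : 3 * c%:R < q.
Proof. by rewrite -natrM ltr_nat (adm_lt adm). Qed.

Lemma kappa_ge0 : 0 <= kappa.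
Proof.
have : 0 <= q / c%:R by rewrite divr_ge0.
by rewrite /kappa; lra.
Qed.

Lemma not_small_quotient (b : nat) : b \in s -> ~~ small Q b -> exists e,
  (b * e = Q - 1 \/ b * e = Q + 1)%N.
Proof.
move=> bs nsb; have b1 : b != 1%N by apply: contraNneq nsb => ->.
by have /orP[/dvdnP[e E]|/dvdnP[e E]] := large_dvd adm s1 (one_min adm) f1 bs b1 nsb;
  exists e; rewrite mulnC; [left|right].
Qed.

Lemma row_not_small (b : nat) : b \in s -> ~~ (b %| c)%N -> ~~ small Q b -> q * Kd R Q c b <= kappa.
Proof.
move=> bs bdc nsb; have q1 := Q_ge1000 R Q1000.
have /andP[c64 nsc] := nonpow2_ge64; have c64R := nonpow2_ge64_real.
have [e eE] := not_small_quotient bs nsb; have [g gE] := not_small_quotient cs nsc.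
have := dual_dist adm s1 bs cs bdc eE gE.
rewrite -(ler_nat R) natrD natrM => ddist.
have gR : c%:R * g%:R <= q + 1.
  by have : (c * g <= Q + 1)%N by [case: gE => ->; clear; lia]; rewrite -(ler_nat R) natrM natrD.
have eR : 19 * e%:R <= q + 1.
  have : (19 * e <= Q + 1)%N.
    apply: leq_trans (_ : b * e <= _)%N; first by rewrite leq_mul2r (not_small_ge19 Q1000 nsb) orbT.
    by case: eE => ->; clear; lia.
  by rewrite -(ler_nat R) natrM natrD.
have qe : 0 < q - e%:R by lra.
have := K_le_lin (sdist_gt0 adm cs bs) (sdist_le_half adm cs bs) qe; rewrite -/(Kd R Q c b).
move=> /(_ g ltac:(lra)) Kb.
have q0 : 0 < q by lra.
apply: le_trans (ler_wpM2l (ltW q0) Kb) _.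
rewrite mulrDr; apply: lerD; last by rewrite mulrC divfK ?gt_eqF.
rewrite [107 / 100 * q]mulrC -mulrA ler_pM2l//.
rewrite ler_pdivrMr// mulrAC ler_pdivlMr; last by lra.
by lra.
Qed.

Lemma row_above (b : nat) : b \in s -> ~~ (b %| c)%N -> (c < b)%N ->
  q * Kd R Q c b <= 29 / 100 * b%:R.
Proof.
move=> bs bdc cb; have /andP[c64 nsc] := nonpow2_ge64; have c64R := nonpow2_ge64_real.
have nsb : ~~ small Q b by apply: contra nsc; apply: small_le; apply: ltnW.
apply: le_trans (row_not_small bs bdc nsb) _; rewrite /kappa.
have cR : 4 * q <= c%:R ^+ 2 by rewrite -natrX -natrM ler_nat.
have qc : 107 / 100 * q / c%:R <= 107 / 100 * (c%:R / 4).
  by rewrite ler_pdivrMr; lra.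
have : c%:R + 1 <= b%:R :> R by rewrite natr1 ler_nat.
by lra.
Qed.

Lemma row_small (b : nat) : b \in s -> ~~ (b %| c)%N -> q * Kd R Q c b <= 221 / 100 * b%:R.
Proof.
move=> bs bdc; have c3 := three_mul_lt; have c64R := nonpow2_ge64_real.
have b2 : 2 <= b%:R :> R.
  by rewrite ler_nat; have := adm_gt0 adm bs; case: (b) bdc => [|[|]]//; rewrite dvd1n.
have q0 : 0 < q by lra.
have qc : 0 < q - c%:R by lra.
apply: le_trans (ler_wpM2l (ltW q0) (Kd_ndvd R adm cs bs bdc)) _.
have -> : q * (b%:R / (q - c%:R) + 141 / 100 / q) = b%:R * (q / (q - c%:R)) + 141 / 100.
  by field; rewrite !gt_eqF.
have : q / (q - c%:R) <= 3 / 2 by rewrite ler_pdivrMr//; lra.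
move=> /(ler_wpM2l (ler0n R b)).
by lra.
Qed.

Lemma rowsum_split : q * rowsum R Q s c = q * divisor_sum R Q s c +
  \sum_(b <- s | (b != c) && ~~ (b %| c)%N) q * Kd R Q c b.
Proof.
rewrite /rowsum /divisor_sum (bigID (fun b => b %| c)%N)/= mulrDr.
by congr (_ + _); rewrite mulr_sumr.
Qed.

Lemma sum_ndvd_le : \sum_(b <- s | (b != c) && ~~ (b %| c)%N) b%:R <= q - c%:R :> R.
Proof.
apply: le_trans (sum_others_real R adm cs).
rewrite [leRHS](bigID (fun b => b %| c)%N)/= lerDr.
by apply: sumr_ge0.
Qed.

Lemma pow_below (b : nat) : b \in s -> (b < c)%N -> pow2 b.
Proof. by move=> bs bc; apply: contraT => /(cmin bs); rewrite leqNgt bc. Qed.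

Lemma rowsum_large_nonpow2_lt : rowsum R Q s c < 1.
Proof.
have q1 := Q_ge1000 R Q1000; have c64 := nonpow2_ge64_real; have c3 := three_mul_lt.
have q0 : 0 < q by lra.
have [D [m [cE Dp mo m3 Dc]]] := pow2_part (adm_gt0 adm cs) cpow.
have k0 := kappa_ge0; have us := adm_uniq adm.
have kE : kappa * c%:R = 107 / 100 * q + 141 / 100 * c%:R.
  by rewrite /kappa mulrDl divfK// gt_eqF//; lra.
have D0 : (0 < D)%N by have := adm_gt0 adm cs; rewrite cE; case: (D).
have m0 : (0 < m)%N by rewrite (leq_trans _ m3).
have P1 : q * divisor_sum R Q s c <= q * (2 / m%:R - 1 / c%:R) + 2.
  apply: le_trans (ler_wpM2l (ltW q0) (divisor_sum_le R adm cs cmin D0 Dc)) _.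
  rewrite mulrDr; apply: lerD.
    rewrite ler_pM2l// mulrBl lerD2r cE natrM.
    have -> : 2 * D%:R / (D%:R * m%:R) = 2 / m%:R :> R by field; rewrite !pnatr_eq0 -!lt0n m0.
    exact: lexx.
  have -> : q * (406 / 100 * c%:R / q ^+ 2) = 406 / 100 * c%:R / q by field; rewrite gt_eqF.
  by rewrite ler_pdivrMr//; lra.
rewrite -(ltr_pM2l q0) mulr1 rowsum_split.
apply: le_lt_trans (lerD P1 (lexx _)) _.
have sn := sum_ndvd_le.
have [m5|m5] := leqP 5 m; last first.
  have mE : m = 3 by case: (m) mo m3 m5 => [|[|[|[|[|]]]]].
  have cD : c = (D * 3)%N by rewrite cE mE.
  have S : \sum_(b <- s | (b != c) && ~~ (b %| c)%N) q * Kd R Q c b <=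
      29 / 100 * (q - c%:R) + kappa.
    apply: (@le_trans _ _ (\sum_(b <- s | (b != c) && ~~ (b %| c)%N)
        (29 / 100 * b%:R + if b \in [:: 2 * D]%N then kappa else 0))).
      rewrite big_seq_cond [leRHS]big_seq_cond; apply: ler_sum => b /and3P[bs bc bdc].
      have [cb|bltc] := ltnP c b.
        apply: ler_wpDr; last exact: row_above.
        by case: ifP.
      have {}bltc : (b < c)%N by rewrite ltn_neqAle bc.
      have bE : b = (2 * D)%N.
        have bp := pow_below bs bltc.
        by apply: (pow2_between Dp bp); rewrite -?Dc// -cD.
      rewrite bE mem_seq1 eqxx -bE; apply: ler_wpDl; first by rewrite mulr_ge0// divr_ge0.
      by apply: row_not_small; rewrite // bE not_small_two_thirds// -cD.
    rewrite big_split/= -mulr_sumr; apply: lerD; first by rewrite ler_wpM2l// divr_ge0.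
    rewrite -big_mkcondr/=.
    apply: le_trans (@ler_sum_sub _ s [:: (2 * D)%N] _ _ us _ _) _; last by rewrite big_seq1.
      by move=> b _ /andP[].
    by move=> b _.
  apply: le_lt_trans (lerD (lexx _) S) _; rewrite /kappa mE.
  have : q / c%:R <= q / 64 by rewrite ler_pM2l// lef_pV2 ?posrE//; lra.
  by lra.
have [t tsm tmax] := small_max Q.
(* Elements above [c] cost [29 / 100 b]. Those below are powers of 2: the small ones have sum below
   [2 t]; a non-small one is at least 19, so [kappa <= kappa / 19 * b], and all of these have sum
   below [2 c], where [kappa c] is about [107 / 100 Q]. *)
have S : \sum_(b <- s | (b != c) && ~~ (b %| c)%N) q * Kd R Q c b <=
    29 / 100 * (q - c%:R) + 221 / 100 * (2 * t%:R) + kappa / 19 * (2 * c%:R).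
  apply: (@le_trans _ _ (\sum_(b <- s | (b != c) && ~~ (b %| c)%N)
      (29 / 100 * b%:R + (if (b < c)%N && small Q b then 221 / 100 * b%:R else 0) +
       (if (b < c)%N then kappa / 19 * b%:R else 0)))).
    rewrite big_seq_cond [leRHS]big_seq_cond; apply: ler_sum => b /and3P[bs bc bdc].
    have kb : 0 <= kappa / 19 * b%:R by rewrite mulr_ge0// divr_ge0.
    have b0 : 0 <= b%:R :> R by [].
    have [cb|bltc] := ltnP c b.
      by rewrite ltnNge (ltnW cb)/= !addr0; exact: row_above.
    rewrite ltn_neqAle bc bltc/=.
    case: ifPn => [_|nsb]; first by have := row_small bs bdc; lra.
    have b19 : 19 <= b%:R :> R by rewrite ler_nat (not_small_ge19 Q1000).
    have : kappa * 19 <= kappa * b%:R by rewrite ler_wpM2l.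
    by have := row_not_small bs bdc nsb; lra.
  rewrite !big_split/= -mulr_sumr; apply: lerD; first apply: lerD; first by rewrite ler_wpM2l// divr_ge0.
    rewrite -big_mkcondr/= -mulr_sumr ler_wpM2l ?divr_ge0// -natr_sum -natrM ler_nat ltnW//.
    apply: sum_pow2_lt => //; first by rewrite (leq_trans _ (tmax 11 _)).
    by move=> b bs /and3P[_ bc bsm]; rewrite pow_below// tmax.
  rewrite -big_mkcondr/= -mulr_sumr ler_wpM2l ?divr_ge0// -natr_sum -natrM ler_nat ltnW//.
  apply: sum_pow2_lt => //; first exact: adm_gt0 adm _ cs.
  by move=> b bs /andP[_ bc]; rewrite pow_below// ltnW.
apply: le_lt_trans (lerD (lexx _) S) _.
have mi : q * (2 / m%:R) <= q * (4 / 10).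
  rewrite ler_pM2l// ler_pdivrMr ?ltr0n//.
  by have : 5 <= m%:R :> R by [rewrite ler_nat]; lra.
have qc0 : 0 <= q / c%:R by rewrite divr_ge0.
have tb : 442 / 100 * t%:R <= 14 / 1000 * q + 72.
  have t0 : 0 <= t%:R :> R by [].
  have : 0 <= (t%:R - 11 - 10) ^+ 2 :> R by rewrite sqr_ge0.
  by have /orP[] := small_real R tsm; lra.
by lra.
Qed.

End LargeFirstNonPow2.

Section LeastOne.
Variables (R : realType) (Q : nat) (s : seq nat).
Hypotheses (adm : admissible Q s) (s1 : 1%N \in s) (Q1000 : (1000 <= Q)%N).
Local Notation q := (Q%:R : R).
Local Notation p := (q - 1%:R : R).

(** Powers of 2 up to [Q / 3] add up to less than [2 Q / 3], which leaves ample room for the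
    excesses. *)
Lemma rowsum_pow2_lt : {in s, forall b, pow2 b} -> rowsum R Q s 1 < 1.
Proof.
move=> sp; have q1 := Q_ge1000 R Q1000; have us := adm_uniq adm.
have p0 : 0 < p := Q_sub_gt0 R adm s1.
set n : R := (size s)%:R.
have n2 : n ^+ 2 <= 2 * q.
  rewrite /n -natrX -natrM ler_nat.
  apply: leq_trans (sqr_size_le us (adm_gt0 adm)) _.
  by rewrite leq_mul2l adm_sum.
have S : 3 * \sum_(b <- s | b != 1%N) b%:R <= 2 * q.
  rewrite -natr_sum -!natrM ler_nat.
  have Q3 : (0 < Q %/ 3)%N by rewrite divn_gt0// (leq_trans _ Q1000).
  have : (\sum_(b <- s | b != 1) b < 2 * (Q %/ 3))%N.
    apply: sum_pow2_lt => // b bs _; rewrite sp// leq_divRL// mulnC.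
    exact: ltnW (adm_lt adm bs).
  move: (leq_trunc_div Q 3); clear.
  by lia.
have X := sum_excess_le R adm s1 (one_min adm).
rewrite -(ltr_pM2l p0) mulr1.
have tot : p * rowsum R Q s 1 <= \sum_(b <- s | b != 1%N) b%:R + \sum_(b <- s | b != 1%N) excess b%:R.
  rewrite -big_split/= mulr_sumr big_seq_cond [leRHS]big_seq_cond.
  apply: ler_sum => b /andP[bs b1]; exact: (min_row_le R adm s1 (one_min adm) bs b1).
have : 0 <= (n - 45) ^+ 2 by rewrite sqr_ge0.
by rewrite -/n in X; lra.
Qed.

Lemma exists_row_one : exists2 c, c \in s & rowsum R Q s c < 1.
Proof.
have [f1|f1] := ltP (rowsum R Q s 1) 1; first by exists 1%N.
have [/allP sp|] := boolP (all pow2 s).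
  by have := rowsum_pow2_lt sp; exists 1%N.
rewrite -has_predC => /hasP[c0 c0s c0p].
have ex : exists c, (c \in s) && ~~ pow2 c by exists c0; rewrite c0s.
case: (ex_minnP ex) => c /andP[cs cp] cmin.
have cmin' : {in s, forall b, ~~ pow2 b -> (c <= b)%N}.
  by move=> b bs bp; apply: cmin; rewrite bs.
exists c => //.
have [cQ|cQ] := leqP (4 * Q) (c ^ 2); first exact: rowsum_large_nonpow2_lt f1 cs cp cmin' cQ.
have [c10|c10] := leqP 10 c.
  by have := two_rowsums_ge10_lt R adm s1 Q1000 cs cp cmin' c10 cQ; lra.
by have := two_rowsums_lt10_lt R adm s1 Q1000 cs cp cmin' c10; lra.
Qed.

End LeastOne.

(** * Conclusion *)

Lemma check_all_range : all check_all (range 296 4).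
Proof. by vm_compute. Qed.

Lemma check_one_range : all check_one (range 700 300).
Proof. by vm_compute. Qed.

Lemma exists_row (R : realType) (Q : nat) (s : seq nat) : admissible Q s -> s != [::] ->
  exists2 c, c \in s & (rowsum R Q s c < 1)%R.
Proof.
move=> adm sn; have Q4 := adm_Q adm.
have [Q300|Q300] := ltnP Q 300.
  apply: (check_all_sound R adm sn); have /allP := check_all_range; apply.
  by rewrite mem_range; clear -Q4 Q300; lia.
have [a as_ amin] := exists_min sn.
have [a2|a1] := ltnP 1 a; first exact: (exists_row_min_ge2 R adm as_ amin a2 Q300).
have {a1 amin}aE : a = 1%N by apply/eqP; rewrite eqn_leq a1 (adm_gt0 adm as_).
rewrite {}aE in as_; have [Q1000|Q1000] := ltnP Q 1000; last exact: exists_row_one.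
apply: (check_one_sound R adm as_ Q1000); have /allP := check_one_range; apply.
by rewrite mem_range; clear -Q1000 Q300; lia.
Qed.

Theorem theorem4p2 (R : realType) (Q : nat) (A : {fset nat}) :
  (4 <= Q)%N ->
  A != fset0 ->
  (forall a : nat, a \in A -> (0 < a)%N) ->
  (forall a : nat, a \in A -> coprime a Q) ->
  (forall a : nat, a \in A -> (3 * a < Q)%N) ->
  (\sum_(a <- A) a <= Q)%N ->
  exists2 a : nat, a \in A &
    \sum_(b <- A `\ a) K R Q (modnorm (a%:R * b%:R^-1 : 'Z_Q)) < 1.
Proof.
move=> Q4 A0 gt0A copA ltA sumA.
have adm : admissible Q A by split=> //; exact: fset_uniq.
have sn : (A : seq nat) != [::].
  by apply: contra_neq A0 => A0; apply/fsetP => x; rewrite inE -[x \in A]/(x \in (A : seq nat)) A0.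
have [c cA lt1] := exists_row R adm sn; exists c => //.
rewrite (perm_big [seq b <- A | b != c]); first by rewrite big_filter.
apply: uniq_perm; [exact: fset_uniq|exact/filter_uniq/fset_uniq|].
by move=> x; rewrite mem_filter !inE.
Qed.
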